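(* Let $d\ge1$, $K>0$, $U$ a non-negative polynomial of degree $4$ with strictly positive leading coefficient, and let $\Phi_t:\mathcal{X}_0\to\mathcal{X}_0$ be the flow of the anharmonic lattice system described in the context. Let $\omega$ be a time invariant state (as defined in the context). Let $f,g:\mathbb{R}^2\to\mathbb{R}$ be differentiable functions which are bounded together with their derivatives, and for $i,j\in\mathbb{Z}^d$ let $f_i(x)=f(x_i)$, $g_j(x)=g(x_j)$. Then for every $i\in\mathbb{Z}^d$, every $\alpha>1/2$ and every $b>0$, $$\lim_{t\to\infty}\ \sup_{j\in\mathbb{Z}^d:\,|i-j|>t\log^\alpha t} e^{bt}\,\{f_i,\Phi_t g_j\}(x)=0$$ for $\omega$-almost every $x$.
   Context: Configurations are $x=\{(q_i,p_i)\}_{i\in\mathbb{Z}^d}\in\mathcal{X}=(\mathbb{R}^2)^{\mathbb{Z}^d}$ with the product topology; $|i-j|=\sum_{\ell=1}^d|i_\ell-j_\ell|$. The dynamics is $\dot q_i=p_i$, $\dot p_i=-U'(q_i)-K\sum_{j:|j-i|=1}(q_i-q_j)$, $i\in\mathbb{Z}^d$. For $\nu\in\mathbb{Z}^d$, $k\in\mathbb{N}$, $\Lambda_{\nu,k}$ is the cube of center $\nu$ and side $2k+1$, $W_{\nu,k}(x)=\sum_{i\in\Lambda_{\nu,k}}\{p_i^2/2+U(q_i)+1\}+\sum_{i,j\in\Lambda_{\nu,k},|j-i|=1}\frac K4(q_i-q_j)^2$, $Q(x)=\sup_{\nu\in\mathbb{Z}^d}\sup_{k>\log^{1/d}(e+|\nu|)}W_{\nu,k}(x)/(2k+1)^d$,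 and $\mathcal{X}_0=\{x:Q(x)<\infty\}$. $\Phi_t:\mathcal{X}_0\to\mathcal{X}_0$, $t\in\mathbb{R}$, denotes the one-parameter group giving the unique global solution of the dynamics with $\Phi_0(x)=x$; $\Phi_t(x)_j$ is differentiable in each $x_i$. For a function $h$ on $\mathcal{X}$, $\Phi_t h(x)=h(\Phi_t(x))$. $\mathcal{U}$ is the algebra of local observables: functions $f(x)=f_\Lambda(x_\Lambda)$ for some bounded $\Lambda\subset\mathbb{Z}^d$ and a differentiable $f_\Lambda$ bounded with its derivatives. Poisson bracket: $\{f,g\}(x)=\sum_{i}\bigl(\frac{\partial f}{\partial q_i}\frac{\partial g}{\partial p_i}-\frac{\partial f}{\partial p_i}\frac{\partial g}{\partial q_i}\bigr)(x)$. A time invariant state is a Borel probability measure $\omega$ on $\mathcal{X}$ such that (i) there is $C_\omega>0$ with $\omega(e^{\lambda W_{\nu,k}})\le e^{C_\omega(2k+1)^d}$ for all $\nu\in\mathbb{Z}^d$, $k\in\mathbb{N}$ and all sufficiently small $\lambda>0$, and (ii) $\omega(\Phi_t f)=\omega(f)$ for all $f\in\mathcal{U}$ and $t\in\mathbb{R}$. *)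

(* Defs.v *)
From HB Require Import structures.
From mathcomp Require Import all_boot all_order all_algebra.
From mathcomp Require Import all_classical all_reals all_analysis.
Set Implicit Arguments. Unset Strict Implicit. Unset Printing Implicit Defensive.
Import Order.TTheory GRing.Theory Num.Theory.
Import numFieldNormedType.Exports.
Local Open Scope classical_set_scope.
Local Open Scope ring_scope.

Definition site (d : nat) := {ffun 'I_d -> int}.

(* configurations x = ((q_i, p_i))_i *)
Definition config (R : realType) (d : nat) := site d -> R * R.

Definition sdist d (i j : site d) : nat := \sum_(l < d) `|i l - j l|%N.

Definition shift d (i : site d) (l : 'I_d) (s : bool) : site d :=
  [ffun m => if m == l then (if s then i m + 1 else i m - 1) else i m].

Definition nbrs d (i : site d) : seq (site d) :=
  [seq shift i l s | l <- enum 'I_d, s <- [:: true; false]].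

(* the cube Lambda_{nu,k} of center nu and side 2k+1, enumerated by offsets *)
Definition cube_pt d (nu : site d) (k : nat) (o : {ffun 'I_d -> 'I_(2 * k + 1)}) : site d :=
  [ffun l => nu l + (nat_of_ord (o l))%:Z - k%:Z].

Section Model.
Variables (R : realType) (d : nat) (K : R) (U : {poly R}).

Definition Wloc (nu : site d) (k : nat) (x : config R d) : R :=
  \sum_(o : {ffun 'I_d -> 'I_(2 * k + 1)})
     ((x (cube_pt nu o)).2 ^+ 2 / 2 + U.[(x (cube_pt nu o)).1] + 1)
  + \sum_(o : {ffun 'I_d -> 'I_(2 * k + 1)})
    \sum_(o' : {ffun 'I_d -> 'I_(2 * k + 1)} | sdist (cube_pt nu o') (cube_pt nu o) == 1%N)
       K / 4 * ((x (cube_pt nu o)).1 - (x (cube_pt nu o')).1) ^+ 2.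

Definition Qfun (x : config R d) : \bar R :=
  ereal_sup [set r : \bar R | exists (nu : site d) (k : nat),
     (ln (expR 1 + (sdist nu [ffun=> 0%:Z])%:R : R)) `^ (d%:R^-1) < k%:R
     /\ r = ((Wloc nu k x) / ((2 * k + 1) ^ d)%:R)%:E].

Definition X0 : set (config R d) := [set x | (Qfun x < +oo)%E].

Definition upd (x : config R d) (i : site d) (a : R * R) : config R d :=
  fun j => if j == i then a else x j.

Definition is_flow (Phi : R -> config R d -> config R d) : Prop :=
  [/\ (forall t x, X0 x -> X0 (Phi t x)),
      (forall x, X0 x -> Phi 0 x = x),
      (forall s t x, X0 x -> Phi (s + t) x = Phi s (Phi t x)),
      (forall x, X0 x -> forall (i : site d) (t : R),
         is_derive t (1 : R) (fun s => (Phi s x i).1) (Phi t x i).2 /\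
         is_derive t (1 : R) (fun s => (Phi s x i).2)
           (- (U^`()).[(Phi t x i).1]
            - K * \sum_(j <- nbrs i) ((Phi t x i).1 - (Phi t x j).1))) &
      (forall x, X0 x -> forall t (i j : site d),
         differentiable (fun a : R * R => Phi t (upd x i a) j) (x i))].

Definition dq (h : config R d -> R) (k : site d) (x : config R d) : R :=
  derive1 (fun s : R => h (upd x k (s, (x k).2))) (x k).1.
Definition dp (h : config R d -> R) (k : site d) (x : config R d) : R :=
  derive1 (fun s : R => h (upd x k ((x k).1, s))) (x k).2.

(* Poisson bracket {f, h}, where f depends only on the coordinates in the
   finite set of sites Lam (all other terms of the sum vanish) *)
Definition pbracket (Lam : seq (site d)) (f h : config R d -> R) (x : config R d) : R :=
  \sum_(k <- Lam) (dq f k x * dp h k x - dp f k x * dq h k x).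

Definition bounded_C1 (f : R * R -> R) : Prop :=
  [/\ (forall v, differentiable f v),
      (exists M : R, forall v, `|f v| <= M) &
      (exists M : R, forall v u, `|'d f v u| <= M * `|u|)].

Definition local_obs (f : config R d -> R) : Prop :=
  exists (n : nat) (lam : 'I_n.+1 -> site d) (F : 'rV[R]_n.+1 * 'rV[R]_n.+1 -> R),
    [/\ (forall x, f x = F (\row_m (x (lam m)).1, \row_m (x (lam m)).2)),
        (forall v, differentiable F v),
        (exists M : R, forall v, `|F v| <= M) &
        (exists M : R, forall v u, `|'d F v u| <= M * `|u|)].

Definition borelX : set (set (config R d)) :=
  [set A | @open {ptws site d -> (R * R)%type} A].

Definition Xmeas := g_sigma_algebraType borelX.

Definition time_invariant_state (Phi : R -> config R d -> config R d)
    (om : probability Xmeas R) : Prop :=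
  (exists C : R, 0 < C /\ exists lam0 : R, 0 < lam0 /\
     forall lam : R, 0 < lam -> lam < lam0 ->
     forall (nu : site d) (k : nat),
       (\int[om]_x (expR (lam * Wloc nu k x))%:E
          <= (expR (C * ((2 * k + 1) ^ d)%:R))%:E)%E)
  /\ (forall f, local_obs f -> forall t : R,
       (\int[om]_x (f (Phi t x))%:E = \int[om]_x (f x)%:E)%E).

End Model.

(* Main.v *)
(** The site energies e_k = p_k^2/2 + U(q_k) + 1 satisfy |de_k/dt| <= C sum_(|j-k|<=1) e_j,
    so, among solutions bounded by a multiple of log(e + |k|) uniformly on bounded time
    intervals, energies grow at most exponentially relative to the weights log(e + r + |k|),
    for every r >= 0.  Membership in X_0 gives the a priori bound only at each fixed time;
    a Baire argument makes it locally uniform in time.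

    For a typical x, exponential moments and invariance give e_k(Phi_n x) <= A log(e + n + |k|)
    at all integer times n, hence e_k(Phi_s x) <= A' log(e + t + |k|) for 0 <= s <= t.  As
    U''(q) = O(1 + q^2) and q^4 = O(e), the difference of two neighbouring trajectories solves
    a linear system with couplings O(log^(1/2) (e + t + |k|)).  A supersolution decaying
    exponentially in the distance from i then bounds the derivative of Phi_t(x)_j in x_i by
    exp(t log^alpha t - (b + 2)|i - j|) for large t, as soon as alpha > 1/2. *)
Require Import Defs.
From HB Require Import structures.
From mathcomp Require Import all_boot all_order all_algebra.
From mathcomp Require Import all_classical all_reals all_analysis.
From mathcomp Require Import measurable_realfun ring lra zify.
Set Implicit Arguments.
Unset Strict Implicit.
Unset Printing Implicit Defensive.
Import Order.TTheory GRing.Theory Num.Theory.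
Import numFieldNormedType.Exports.
Local Open Scope classical_set_scope.
Local Open Scope ring_scope.

(** In an infinite system a differential inequality controls nothing by itself: a comparison holds
    only within an a priori growth class, so each estimate is preceded by a cruder one that places
    the solution in such a class. The energy inequality is linear because the on-site force drops
    out of the energy balance, and the work done by the neighbours is quadratic in q and p.
    Differentiability of the flow in one site comes without an equation for the derivative, so the
    estimates concern differences of two trajectories and pass to the derivative only at the end.
    Events at later times are therefore enclosed in measurable sets of small measure, and only
    countably many of them can be treated at once, hence the integer times. Invariance applies to
    bounded observables with bounded derivatives; the tail of an energy is accordingly tested with a
    smooth cutoff and not with the exponential itself. *)

(** * Comparison for infinite systems of differential inequalities *)

Lemma le_of_deriv_ge0 (R : realType) (h h' : R -> R) (a b : R) :
  a <= b -> (forall s, a <= s <= b -> is_derive s (1 : R) h (h' s)) ->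
  (forall s, a <= s <= b -> 0 <= h' s) -> h a <= h b.
Proof.
move=> ab dh h'0.
have hc : {within `[a, b], continuous h}.
  apply: derivable_within_continuous => s; rewrite in_itv /= => sab.
  by have [] := dh _ sab.
have [|c cab E] := @MVT_segment _ h h' a b ab _ hc.
  by move=> s; rewrite in_itv /= => /andP[a1 b1]; apply: dh; rewrite !ltW.
by rewrite -subr_ge0 E mulr_ge0 ?subr_ge0// h'0// (itvP cab).
Qed.

Lemma norm_le_of_deriv (R : realType) (u u' v v' : R -> R) (T : R) :
  (forall s, 0 <= s <= T -> is_derive s (1 : R) u (u' s)) ->
  (forall s, 0 <= s <= T -> is_derive s (1 : R) v (v' s)) ->
  (forall s, 0 <= s <= T -> `|u' s| <= v' s) -> `|u 0| <= v 0 ->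
  forall s, 0 <= s <= T -> `|u s| <= v s.
Proof.
move=> du dv uv' uv0 s /andP[s0 sT].
have sub r : 0 <= r <= s -> 0 <= r <= T by move=> /andP[-> rs]; exact: le_trans sT.
have := @le_of_deriv_ge0 R (v \- u) (v' \- u') 0 s s0.
have := @le_of_deriv_ge0 R (v \+ u) (v' \+ u') 0 s s0 => /=.
move=> H1 H2.
have {}H1 : v 0 + u 0 <= v s + u s.
  apply: H1 => r /sub rT; first exact: is_deriveD (dv _ rT) (du _ rT).
  by have := uv' _ rT; rewrite ler_norml; lra.
have {}H2 : v 0 - u 0 <= v s - u s.
  apply: H2 => r /sub rT; first exact: is_deriveB (dv _ rT) (du _ rT).
  by have := uv' _ rT; rewrite ler_norml; lra.
by move: uv0; rewrite !ler_norml; lra.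
Qed.

Lemma le_of_le_halves (R : realType) (a b c : R) :
  (forall n : nat, a <= b + c / 2 ^+ n) -> a <= b.
Proof.
move=> h.
have cv : ((fun n : nat => b + c / 2 ^+ n : R) @ \oo --> (b + 0 : R)).
  apply: cvgD; first exact: cvg_cst.
  have := @cvg_geometric R c (2^-1) _; rewrite ger0_norm// => /(_ _).
  rewrite invf_lt1 ?ltr1n// => /(_ isT).
  by apply: cvg_trans; apply: near_eq_cvg; near=> n; rewrite /geometric /= exprVn.
rewrite addr0 in cv; rewrite -(cvg_lim _ cv)//.
by apply: limr_ge; [apply/cvg_ex; exists b|near=> n; exact: h].
Unshelve. all: by end_near. Qed.

Lemma is_derive_cexp (R : realType) (A b s : R) :
  is_derive s (1 : R) (fun s => A * expR (s * b)) (b * (A * expR (s * b))).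
Proof.
have d1 : is_derive s (1 : R) (fun s => s * b) b.
  have := @is_deriveZ R R R id b s 1 1 (is_derive_id s 1).
  rewrite /GRing.scale /= mulr1; congr is_derive; apply/funext => r /=.
  by rewrite /GRing.scale /= mulrC.
have d2 := @is_derive1_comp R expR (fun s => s * b) s _ _ (is_derive_expR _) d1.
have := @is_deriveZ R R R _ A s 1 _ d2.
suff -> : A *: (expR (s * b) * b) = b * (A * expR (s * b)) by [].
by rewrite /GRing.scale /=; ring.
Qed.

(* [V] only serves as an a priori growth class: the error [M V] is halved at each
   integration because [V] is a supersolution for twice the coupling. *)
Lemma lattice_comparison (R : realType) (I G : Type) (nb : I -> seq I)
  (u u' : I -> G -> R -> R) (c : I -> R) (T M : R) (A a C b : I -> R) :
  (forall k g s, 0 <= s <= T -> is_derive s (1 : R) (u k g) (u' k g s)) ->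
  (forall k g s (w : I -> R), 0 <= s <= T -> (forall j g', `|u j g' s| <= w j) ->
     `|u' k g s| <= c k * \sum_(j <- nb k) w j) ->
  (forall k s, 0 <= s <= T ->
     c k * \sum_(j <- nb k) A j * expR (s * a j) <= a k * (A k * expR (s * a k))) ->
  (forall k s, 0 <= s <= T ->
     2 * (c k * \sum_(j <- nb k) C j * expR (s * b j)) <= b k * (C k * expR (s * b k))) ->
  (forall k, 0 <= C k) ->
  (forall k g, `|u k g 0| <= A k) ->
  (forall k g s, 0 <= s <= T -> `|u k g s| <= M * (C k * expR (s * b k))) ->
  forall k g s, 0 <= s <= T -> `|u k g s| <= A k * expR (s * a k).
Proof.
move=> du hu hA hC C0 u0 apriori.
have A0 k (g : G) : 0 <= A k.
  by apply: le_trans (u0 k g); rewrite normr_ge0.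
wlog M0 : M apriori / 0 <= M.
  move=> W; apply: (W `|M|) => // k g s sT.
  apply: le_trans (apriori k g s sT) _; apply: ler_wpM2r (ler_norm M).
  by rewrite mulr_ge0 ?expR_ge0.
have ind (n : nat) k g s : 0 <= s <= T ->
    `|u k g s| <= A k * expR (s * a k) + M / 2 ^+ n * (C k * expR (s * b k)).
  elim: n k g s => [|n IH] k g s sT.
    rewrite expr0 divr1; apply: le_trans (apriori k g s sT) _.
    by rewrite lerDr mulr_ge0 ?expR_ge0// (A0 _ g).
  pose v r := A k * expR (r * a k) + M / 2 ^+ n.+1 * (C k * expR (r * b k)).
  pose v' r := a k * (A k * expR (r * a k)) +
      M / 2 ^+ n.+1 * (b k * (C k * expR (r * b k))).
  have Mn0 m : 0 <= M / 2 ^+ m by rewrite divr_ge0// exprn_ge0.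
  apply: (@norm_le_of_deriv R (u k g) (u' k g) v v' T) => // [r rT|r rT|].
  - apply: is_deriveD; first exact: is_derive_cexp.
    exact: (is_deriveZ _ (is_derive_cexp _ _ _)).
  - apply: le_trans (hu k g r _ rT (fun j g' => IH j g' r rT)) _.
    rewrite big_split /= mulrDr; apply: lerD; first exact: hA.
    have -> : M / 2 ^+ n.+1 = M / 2 ^+ n * 2^-1 by rewrite exprS invfM; ring.
    rewrite -mulr_sumr (mulrCA (c k)) -(mulrA (M / 2 ^+ n)).
    by apply: ler_wpM2l => //; rewrite ler_pdivlMl//; exact: hC.
  - rewrite /v !mul0r expR0 !mulr1; apply: le_trans (u0 k g) _.
    by rewrite lerDl mulr_ge0.
move=> k g s sT; apply: (@le_of_le_halves R _ _ (M * (C k * expR (s * b k)))) => n.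
by apply: le_trans (ind n k g s sT) _; rewrite mulrAC.
Qed.

(** * From pointwise bounds to locally uniform bounds *)

Lemma nested_intervals (R : realType) (a b : nat -> R) :
  (forall n, a n <= b n) -> (forall n, a n <= a n.+1) -> (forall n, b n.+1 <= b n) ->
  exists c, forall n, a n <= c <= b n.
Proof.
move=> ab /nondecreasing_seqP ha /nonincreasing_seqP hb.
have anb n m : a n <= b m.
  case: (leqP n m) => nm; first by apply: le_trans (ha _ _ nm) (ab m).
  by apply: le_trans (ab n) (hb _ _ (ltnW nm)).
have hs : has_sup (range a).
  by split; [exists (a 0%N); exists 0%N|exists (b 0%N) => _ [n _ <-]].
exists (sup (range a)) => n; apply/andP; split.
  by apply: ub_le_sup; [case: hs|exists n].
by apply: ge_sup; [case: hs|move=> _ [m _ <-]].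
Qed.

(* A Baire-type argument.  If the bound fails on an interval, then for every [M] it
   also fails on a subinterval throughout which [M] is exceeded: otherwise, going
   backwards from any time [t0], the quantitative bound [gron] keeps the solution
   bounded until a time at which [M] is not exceeded, and from there it propagates
   back to [t0].  Nesting such subintervals contradicts pointwise finiteness. *)
Lemma bounded_of_pointwise_bounded (R : realType) (I : Type) (E : I -> R -> R)
  (L : I -> R) (G a0 b0 : R) :
  (forall k, 0 <= L k) -> 1 <= G -> (forall k, continuous (E k)) ->
  (forall a b M s s', a0 <= a -> b <= b0 ->
     (exists N, forall r, a <= r <= b -> forall k, E k r <= N * L k) ->
     a <= s <= b -> a <= s' <= b -> (forall k, E k s <= M * L k) ->
     forall k, E k s' <= G * M * L k) ->
  (forall s, exists M, forall k, E k s <= M * L k) ->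
  exists M, forall s, a0 <= s <= b0 -> forall k, E k s <= M * L k.
Proof.
move=> L0 G1 Ec gron pt.
pose bd M s := forall k, E k s <= M * L k.
pose good a b := exists M, forall s, a <= s <= b -> bd M s.
have bdW M N s : M <= N -> bd M s -> bd N s.
  by move=> MN h k; apply: le_trans (h k) _; apply: ler_wpM2r.
case: (pselect (good a0 b0)) => // ngood; exfalso.
have [ab0|ba0] := leP a0 b0; last first.
  by apply: ngood; exists 0 => s /andP[h1 h2]; have := le_trans h1 h2; rewrite leNgt ba0.
have step a b M : a0 <= a -> a <= b -> b <= b0 -> ~ good a b ->
    exists p : R * R, [/\ a <= p.1, p.1 <= p.2, p.2 <= b, ~ good p.1 p.2 &
      forall s, p.1 <= s <= p.2 -> ~ bd M s].
  move=> a0a ab bb0 nab; apply: contrapT => nex.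
  have loc a' b' : a <= a' -> a' <= b' -> b' <= b ->
      (forall s, a' <= s <= b' -> ~ bd M s) -> good a' b'.
    by move=> h1 h2 h3 h4; apply: contrapT => ng; apply: nex; exists (a', b').
  have [M0 hM0] := pt a.
  pose M1 := Num.max M (Num.max M0 0).
  have MM1 : M <= M1 by rewrite le_max lexx.
  have M10 : 0 <= M1 by rewrite !le_max lexx !orbT.
  have hM1 : bd M1 a by apply: bdW hM0; rewrite !le_max lexx !orbT.
  apply: nab; exists (G * M1) => t0 /andP[at0 t0b].
  (* [S] collects the times from which the solution stays bounded up to [t0]. Its infimum [c] is
     shown to belong to it, and then to be a time at which [M1] is not exceeded. *)
  pose S := [set s | a <= s <= t0 /\ good s t0].
  have St0 : S t0.
    split; first by rewrite at0 lexx.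
    have [N hN] := pt t0; exists N => s /andP[h1 h2].
    by have -> : s = t0 by apply/eqP; rewrite eq_le h1 h2.
  have hS : has_inf S by split; [exists t0|exists a => s [/andP[]]].
  have ac : a <= inf S by apply: lb_le_inf; [exists t0|move=> s [/andP[]]].
  have ct0 : inf S <= t0 by apply: ge_inf => //; exists a => s [/andP[]].
  set c := inf S in ac ct0.
  have [M2 hM2] := pt t0; have [M3 hM3] := pt c.
  (* Every [s > c] lies in an interval ending at [t0] on which some bound holds, so [gron] started
     at [t0] gives [G * M2], which no longer depends on that interval; [c] itself is covered by
     [M3]. *)
  have gc : good c t0.
    exists (Num.max (G * M2) M3) => s /andP[cs st0].
    move: cs; rewrite le_eqVlt => /predU1P[<-|cs].
      by apply: bdW hM3; rewrite le_max lexx orbT.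
    have [|r [/andP[ar rt0] gr] rs] := @inf_adherent R S (s - c) _ hS.
      by rewrite subr_gt0.
    apply: (@bdW (G * M2)); first by rewrite le_max lexx.
    apply: (gron r t0 M2 t0 s) => //.
    - exact: le_trans ar.
    - exact: le_trans bb0.
    - by rewrite rt0 lexx.
    - by rewrite st0 andbT ltW// (lt_le_trans rs)// -/c; lra.
  suff bc : bd M1 c.
    apply: (gron c t0 M1 c t0) => //.
    - exact: le_trans ac.
    - exact: le_trans bb0.
    - by rewrite lexx.
    - by rewrite ct0 lexx.
  apply: contrapT => nbc.
  have ltac : a < c.
    by rewrite lt_neqAle ac andbT; apply/eqP => E0; apply: nbc; rewrite -E0.
  have [k hk] : exists k, M1 * L k < E k c.
    apply: contrapT => h; apply: nbc => k; rewrite leNgt; apply/negP => h'.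
    by apply: h; exists k.
  (* One violating site [k] suffices: by continuity it violates [M1] on a whole interval to the left
     of [c]. By [loc] that interval is good, and gluing it to [[c, t0]] contradicts the choice of
     [c]. *)
  have /nbhs_ballP[e /= e0 he] : \forall s \near c, M1 * L k < E k s.
    exact: (@cvgr_gt _ _ _ _ (E k) _ (Ec k c) _ hk).
  pose c' := Num.max a (c - e / 2).
  have c'c : c' < c by rewrite gt_max ltac/=; lra.
  have gc' : good c' c.
    apply: loc => //; [by rewrite le_max lexx|exact: ltW|exact: le_trans ct0 _|].
    move=> s /andP[c's sc] /(_ k); apply/negP; rewrite -ltNge.
    apply: (@le_lt_trans _ _ (M1 * L k)); first exact: ler_wpM2r.
    apply: he; rewrite /ball /= ger0_norm ?subr_ge0//.
    by move: c's; rewrite ge_max => /andP[_]; lra.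
  have : c <= c'.
    apply: ge_inf; first by exists a => s [/andP[]].
    split; first by rewrite le_max lexx /= (le_trans (ltW c'c)).
    have [N1 h1] := gc; have [N2 h2] := gc'.
    exists (Num.max N1 N2) => s /andP[h3 h4].
    have [cs|sc] := leP c s.
      by apply: bdW (h1 s _); rewrite ?cs ?h4// le_max lexx.
    by apply: bdW (h2 s _); rewrite ?h3 ?(ltW sc)// le_max lexx orbT.
  by rewrite leNgt c'c.
(* The first component counts the steps, so that the [n]-th interval is chosen with the bound [n]
   exceeded throughout. *)
pose P (p : nat * (R * R)) := [/\ a0 <= p.2.1, p.2.1 <= p.2.2, p.2.2 <= b0 & ~ good p.2.1 p.2.2].
pose rel (p q : {p | P p}) := [/\ (sval q).1 = (sval p).1.+1,
   (sval p).2.1 <= (sval q).2.1, (sval q).2.2 <= (sval p).2.2 &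
   forall s, (sval q).2.1 <= s <= (sval q).2.2 -> ~ bd (sval p).1%:R s].
have ex p : {q | rel p q}.
  apply: cid; case: p => [[n [a b]] Pp]; have [/= h1 h2 h3 h4] := Pp.
  have [[a' b'] [/= g1 g2 g3 g4 g5]] := step a b n%:R h1 h2 h3 h4.
  have Pq : P (n.+1, (a', b')).
    by split=> //=; [exact: le_trans g1|exact: le_trans h3].
  by exists (exist _ _ Pq).
have P0 : P (0%N, (a0, b0)) by split.
have [f [f0 hf]] := dependent_choice ex (exist _ _ P0).
have [c hc] : exists c, forall n, (sval (f n)).2.1 <= c <= (sval (f n)).2.2.
  apply: nested_intervals => n; first by case: (svalP (f n)).
  - by have [] := hf n.
  - by have [] := hf n.
have fn n : (sval (f n)).1 = n.
  by elim: n => [|n IH]; [rewrite f0|have [-> _ _ _] := hf n; rewrite IH].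
have [M hM] := pt c.
pose n := Num.bound `|M|.
have [_ _ _ /(_ c (hc n.+1))] := hf n; apply; rewrite fn; apply: bdW hM.
by apply: le_trans (ler_norm M) (ltW (archi_boundP (normr_ge0 M))).
Qed.

(** * Lattice distance and estimates for the potential *)

Lemma sdistxx d (i : site d) : sdist i i = 0%N.
Proof. by rewrite /sdist big1 // => l _; rewrite distnn. Qed.

Lemma sdistC d (i j : site d) : sdist i j = sdist j i.
Proof. by apply: eq_bigr => l _; rewrite distnC. Qed.

Lemma sdist_triangle d (j i k : site d) : (sdist i k <= sdist i j + sdist j k)%N.
Proof. by rewrite /sdist -big_split; apply: leq_sum => l _; exact: leqD_dist. Qed.

Lemma sdist_shift d (i : site d) l s : (sdist i (Defs.shift i l s) <= 1)%N.
Proof.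
rewrite /sdist (bigD1 l) //= big1 => [|m ml].
  rewrite addn0 ffunE eqxx; case: s; first by rewrite opprD addrA subrr sub0r abszN.
  by rewrite opprB addrCA subrr addr0.
by rewrite ffunE (negPf ml) distnn.
Qed.

Lemma sdist_nbrs d (i j k : site d) : j \in nbrs i ->
  ((sdist k j <= (sdist k i).+1) && (sdist k i <= (sdist k j).+1))%N.
Proof.
move=> /allpairsP[[l s] /= [_ _ ->]].
have h := sdist_shift i l s; apply/andP; split.
  by apply: leq_trans (sdist_triangle i _ _) _; rewrite -addn1 leq_add2l.
apply: leq_trans (sdist_triangle (Defs.shift i l s) _ _) _.
by rewrite -addn1 leq_add2l sdistC.
Qed.

Lemma size_nbrs d (i : site d) : size (nbrs i) = (2 * d)%N.
Proof. by rewrite size_allpairs size_enum_ord mulnC. Qed.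

Lemma le_sum_const (R : numDomainType) (I : eqType) (s : seq I) (F : I -> R) (a : R) :
  (forall j, j \in s -> F j <= a) -> \sum_(j <- s) F j <= (size s)%:R * a.
Proof.
elim: s => [|x s IH] h; first by rewrite big_nil mul0r.
rewrite big_cons /= -natr1 mulrDl mul1r addrC; apply: lerD.
  by apply: IH => j js; apply: h; rewrite inE js orbT.
by apply: h; rewrite inE eqxx.
Qed.

(** A quarter of the leading term absorbs the cubic term by completing a square, another quarter
    absorbs the resulting quadratic term, and one spare q^2 absorbs the linear term. *)
Lemma quartic_lower_bound (R : realType) (U : {poly R}) :
  size U = 5%N -> 0 < lead_coef U -> (forall r, 0 <= U.[r]) ->
  exists C, 1 <= C /\ forall q, 1 + q ^+ 4 <= C * (U.[q] + 1).
Proof.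
move=> sU lU U0; have c0 : 0 < U`_4 by move: lU; rewrite lead_coefE sU.
have E q : U.[q] = U`_0 + U`_1 * q + U`_2 * q ^+ 2 + U`_3 * q ^+ 3 + U`_4 * q ^+ 4.
  by rewrite horner_coef sU !big_ord_recr big_ord0 /= add0r expr0 mulr1 expr1.
set c := U`_4 in c0 E; set c3 := U`_3 in E; set c2 := U`_2 in E.
set c1 := U`_1 in E; set c00 := U`_0 in E.
(* [B] is minus the quadratic coefficient left over once the cubic term is completed and q^2 is set
   aside; [D] gathers the constants produced by the squares. *)
pose B := c3 ^+ 2 / c - c2 + 1.
pose D := B ^+ 2 / c + c1 ^+ 2 - c00.
have low q : c / 2 * q ^+ 4 - D <= U.[q].
  have h1 : 0 <= c / 4 * (q ^+ 2 + 2 * c3 / c * q) ^+ 2.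
    by apply: mulr_ge0; [lra|exact: sqr_ge0].
  have h2 : 0 <= c / 4 * (q ^+ 2 - 2 * B / c) ^+ 2.
    by apply: mulr_ge0; [lra|exact: sqr_ge0].
  have h3 : 0 <= (q + c1 / 2) ^+ 2 + 3 / 4 * c1 ^+ 2.
    by apply: addr_ge0; [exact: sqr_ge0|apply: mulr_ge0; [lra|exact: sqr_ge0]].
  rewrite -subr_ge0; suff -> : U.[q] - (c / 2 * q ^+ 4 - D) =
     c / 4 * (q ^+ 2 + 2 * c3 / c * q) ^+ 2 + c / 4 * (q ^+ 2 - 2 * B / c) ^+ 2
     + ((q + c1 / 2) ^+ 2 + 3 / 4 * c1 ^+ 2).
    by apply: addr_ge0 h3; apply: addr_ge0 h1 h2.
  by rewrite E /D /B; field; rewrite gt_eqF.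
exists (1 + 2 / c * (1 + `|D|)); split.
  by rewrite lerDl mulr_ge0 ?divr_ge0 ?(ltW c0)// addr_ge0.
move=> q; have := low q; have := U0 q; have := ler_norm D.
move: (normr_ge0 D); set m := `|D| => m0 Dm u0 h.
have k : q ^+ 4 <= 2 / c * (U.[q] + m).
  by rewrite mulrAC ler_pdivlMr//; lra.
have : 0 <= 2 / c * (m * U.[q]) by rewrite !mulr_ge0 // ltW// invr_gt0.
have : 0 <= 2 / c by rewrite divr_ge0 // ltW.
set z := 2 / c in k *; nra.
Qed.

Lemma deriv_quartic_lipschitz (R : realType) (U : {poly R}) :
  size U = 5%N ->
  exists C, 0 <= C /\ forall a b,
    `|U^`().[a] - U^`().[b]| <= C * (1 + a ^+ 2 + b ^+ 2) * `|a - b|.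
Proof.
move=> sU.
have sU' : (size U^`() <= 4)%N.
  by rewrite -ltnS -sU; apply: lt_size_deriv; rewrite -size_poly_eq0 sU.
set V := U^`() in sU' *.
have E q : V.[q] = V`_0 + V`_1 * q + V`_2 * q ^+ 2 + V`_3 * q ^+ 3.
  rewrite (horner_coef_wide _ sU') !big_ord_recr big_ord0 /=.
  by rewrite add0r expr0 mulr1 expr1.
exists (`|V`_1| + `|V`_2| + 2 * `|V`_3|); split; first by rewrite !addr_ge0 ?mulr_ge0.
move=> a b.
have -> : V.[a] - V.[b] = (V`_1 + V`_2 * (a + b) + V`_3 * (a ^+ 2 + a * b + b ^+ 2)) * (a - b).
  by rewrite !E; ring.
rewrite normrM; apply: ler_wpM2r => //.
pose P := 1 + a ^+ 2 + b ^+ 2.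
have h1 : `|V`_1| <= `|V`_1| * P.
  by rewrite ler_peMr// /P -addrA lerDl addr_ge0 ?sqr_ge0.
have h2 : `|V`_2 * (a + b)| <= `|V`_2| * P.
  rewrite normrM; apply: ler_wpM2l => //; rewrite ler_norml /P.
  by have := sqr_ge0 (a - 1); have := sqr_ge0 (b - 1); have := sqr_ge0 (a + 1);
    have := sqr_ge0 (b + 1); have := sqr_ge0 a; have := sqr_ge0 b; lra.
have h3 : `|V`_3 * (a ^+ 2 + a * b + b ^+ 2)| <= `|V`_3| * (2 * P).
  rewrite normrM; apply: ler_wpM2l => //; rewrite ler_norml /P.
  by have := sqr_ge0 (a - b); have := sqr_ge0 (a + b); have := sqr_ge0 a;
    have := sqr_ge0 b; lra.
have := ler_normD (V`_1 + V`_2 * (a + b)) (V`_3 * (a ^+ 2 + a * b + b ^+ 2)).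
have := ler_normD V`_1 (V`_2 * (a + b)).
by rewrite -/P; lra.
Qed.

(** * Energy estimates *)

(** The shift [r] has two uses: it carries the elapsed time, and it pays for moving the centre of
    the weight from the origin to another site. *)
Definition logw (R : realType) (r : R) (m : nat) : R := ln (expR 1 + r + m%:R).

Definition origin d : site d := [ffun=> 0%:Z].

Definition energy (R : realType) d (U : {poly R}) (x : config R d) (k : site d) : R :=
  (x k).2 ^+ 2 / 2 + U.[(x k).1] + 1.

Definition nb d (k : site d) : seq (site d) := k :: nbrs k.

Lemma expR1_ge2 (R : realType) : (2 : R) <= expR 1.
Proof. by have := expR_ge1Dx (1 : R); lra. Qed.

Lemma logw_ge1 (R : realType) (r : R) m : 0 <= r -> 1 <= logw r m.
Proof.
move=> r0; have <- : ln (expR 1) = 1 :> R by exact: expRK.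
rewrite /logw ler_ln ?posrE ?expR_gt0//.
  by have := ler0n R m; lra.
by have := ler0n R m; have := expR_gt0 (1 : R); lra.
Qed.

(** One lattice step multiplies the argument of the logarithm by at most e, so the weight gains at
    most 1, which is at most its own value. The factor is free of [r], and hence so is the growth
    rate of the energies. *)
Lemma logw_double (R : realType) (r : R) m n : 0 <= r -> (m <= n.+1)%N ->
  logw r m <= 2 * logw r n.
Proof.
move=> r0 mn; have e2 := @expR1_ge2 R; have n0 := ler0n R n.
have : logw r m <= logw r n + 1.
  have -> : logw r n + 1 = ln ((expR 1 + r + n%:R) * expR 1).
    by rewrite lnM ?posrE ?expRK //; lra.
  rewrite /logw ler_ln ?posrE.
  - have : (m%:R : R) <= n%:R + 1 by rewrite natr1 ler_nat.
    by nra.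
  - by have := ler0n R m; lra.
  - by apply: mulr_gt0; lra.
by have := logw_ge1 n r0; lra.
Qed.

Lemma logw_mono (R : realType) (r r' : R) m n : 0 <= r -> r <= r' -> (m <= n)%N ->
  logw r m <= logw r' n.
Proof.
move=> r0 rr' mn; have e2 := @expR1_ge2 R; have := ler0n R n; have := ler0n R m => h1 h2.
have : (m%:R : R) <= n%:R by rewrite ler_nat.
by rewrite /logw ler_ln ?posrE; lra.
Qed.

Lemma sum_nb_le (R : realType) d (k : site d) (F : site d -> R) (a : R) :
  (forall j, (sdist k j <= 1)%N -> F j <= a) ->
  \sum_(j <- nb k) F j <= (2 * d + 1)%:R * a.
Proof.
move=> h; apply: le_trans (le_sum_const _) _; last by rewrite /= size_nbrs addn1.
move=> j; rewrite inE => /predU1P[->|jk]; first by apply: h; rewrite sdistxx.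
by apply: h; have /andP[] := sdist_nbrs k jk; rewrite sdistxx.
Qed.

Lemma sdist_near d (k j i : site d) : (sdist k j <= 1)%N -> (sdist j i <= (sdist k i).+1)%N.
Proof.
move=> kj; apply: leq_trans (sdist_triangle k _ _) _.
by rewrite (sdistC j k) -add1n leq_add2r.
Qed.

Lemma sum_nb_logw (R : realType) d (r : R) (k i : site d) : 0 <= r ->
  \sum_(j <- nb k) logw r (sdist j i) <= (2 * d + 1)%:R * (2 * logw r (sdist k i)).
Proof.
by move=> r0; apply: sum_nb_le => j kj; apply: logw_double => //; exact: sdist_near.
Qed.

Section Energy.
Context (R : realType) (d : nat) (K : R) (U : {poly R}).
Hypotheses (K0 : 0 < K) (U0 : forall r : R, 0 <= U.[r]).
Context (CU : R).
Hypotheses (CU1 : 1 <= CU) (hCU : forall q, 1 + q ^+ 4 <= CU * (U.[q] + 1)).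

Lemma energy_ge1 (x : config R d) k : 1 <= energy U x k.
Proof. by rewrite /energy; move: (U0 (x k).1) (sqr_ge0 (x k).2); set a := U.[_]; lra. Qed.

Lemma energy_quartic (x : config R d) k : 1 + (x k).1 ^+ 4 <= CU * energy U x k.
Proof.
apply: le_trans (hCU _) _; apply: ler_wpM2l; first exact: le_trans ler01 CU1.
by rewrite /energy; move: (sqr_ge0 (x k).2); set a := U.[_]; lra.
Qed.

Lemma energy_q2 (x : config R d) k : (x k).1 ^+ 2 <= CU * energy U x k.
Proof.
apply: le_trans (energy_quartic _ _).
by have := sqr_ge0 ((x k).1 ^+ 2 - 1); have := sqr_ge0 (x k).1; nra.
Qed.

Lemma energy_p2 (x : config R d) k : (x k).2 ^+ 2 <= 2 * energy U x k.
Proof. by rewrite /energy; move: (U0 (x k).1); set a := U.[_]; lra. Qed.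

Context (Phi : R -> config R d -> config R d).
Hypothesis flow : is_flow K U Phi.

(** The rate of change of the site energy: the force -U' cancels against the derivative of U(q), and
    only the work done by the springs remains. *)
Definition power (x : config R d) (k : site d) : R :=
  - K * (x k).2 * \sum_(j <- nbrs k) ((x k).1 - (x j).1).

Lemma is_derive_energy x k t : X0 K U x ->
  is_derive t (1 : R) (fun s => energy U (Phi s x) k) (power (Phi t x) k).
Proof.
move=> x0; have [_ _ _ /(_ _ x0 k t)[dqk dpk] _] := flow.
have d1 := is_deriveM dpk dpk.
have d2 := is_deriveZ (2^-1 : R) d1.
have d3 := @is_derive1_comp R (horner U) _ t _ _ (is_derive_poly U _) dqk.
have d4 := is_deriveD d2 (is_deriveD d3 (is_derive_cst (1 : R) t (1 : R))).
have -> : (fun s => energy U (Phi s x) k) =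
  (2^-1 \*: ((fun s => (Phi s x k).2) * (fun s => (Phi s x k).2)))
   + ((horner U \o (fun s => (Phi s x k).1)) + cst 1).
  by apply/funext => s; rewrite /energy /= !fctE addrA mulrC expr2.
pose p := (Phi t x k).2; pose v := U^`().[(Phi t x k).1].
pose S := \sum_(j <- nbrs k) ((Phi t x k).1 - (Phi t x j).1).
have -> : power (Phi t x) k = 2^-1 * (p * (- v - K * S) + p * (- v - K * S)) + (v * p + 0).
  by rewrite /power -/p -/S; field.
exact: d4.
Qed.

(** By Young's inequality each product of p with a difference of positions is at most 3 CU e_k + CU
    e_j. Summing over the 2d neighbours gives the coefficient 6d for e_k, and [6 * d + 1] dominates
    all coefficients. *)
Lemma power_bound (x : config R d) k :
  `|power x k| <= K * CU * (6 * d + 1)%:R * \sum_(j <- nb k) energy U x j.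
Proof.
rewrite /power normrM normrM normrN (gtr0_norm K0) -!mulrA; apply: ler_wpM2l; first exact: ltW.
set p := (x k).2; set E := energy U x.
have step j : `|p| * `|(x k).1 - (x j).1| <= CU * (3 * E k) + CU * E j.
  have : `|p| * `|(x k).1 - (x j).1| <= p ^+ 2 + (x k).1 ^+ 2 / 2 + (x j).1 ^+ 2 / 2.
    rewrite -normrM ler_norml; have := sqr_ge0 (p - (x k).1); have := sqr_ge0 (p - (x j).1).
    by have := sqr_ge0 (p + (x k).1); have := sqr_ge0 (p + (x j).1); lra.
  have := energy_p2 x k; have := energy_q2 x k; have := energy_q2 x j.
  have : E k <= CU * E k by rewrite ler_peMl// (le_trans ler01)// energy_ge1.
  have := sqr_ge0 (x k).1; have := sqr_ge0 (x j).1; rewrite -/E -/p.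
  have := energy_ge1 x k; rewrite -/E; set ek := E k; set ej := E j; lra.
have Ek : 0 <= E k by rewrite (le_trans ler01)// energy_ge1.
have sE : 0 <= \sum_(j <- nbrs k) E j.
  by apply: sumr_ge0 => j _; rewrite (le_trans ler01)// energy_ge1.
apply: (@le_trans _ _ (\sum_(j <- nbrs k) (CU * (3 * E k) + CU * E j))).
  apply: (@le_trans _ _ (\sum_(j <- nbrs k) `|p| * `|(x k).1 - (x j).1|)).
    by rewrite -mulr_sumr; apply: ler_wpM2l => //; exact: ler_norm_sum.
  by apply: ler_sum => j _; exact: step.
rewrite big_split /= big_const_seq iter_addr_0 big_cons -/(E k).
rewrite count_predT size_nbrs -mulr_sumr -(mulr_natl _ (2 * d)) natrD !natrM.
have d0 := ler0n R d.
set S := \sum_(j <- _) _ in sE *.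
have h1 : 0 <= CU * E k by rewrite mulr_ge0 // (le_trans ler01).
have h2 : 0 <= CU * 6 * d%:R * S by rewrite !mulr_ge0 // (le_trans ler01).
rewrite -subr_ge0; apply: le_trans (addr_ge0 h1 h2) _.
by rewrite le_eqVlt; apply/orP; left; apply/eqP; ring.
Qed.

(** The constant of [power_bound] times the factor of [sum_nb_logw]: at this rate the weights
    [logw r], multiplied by an exponential in time, form a supersolution for every [r >= 0]. *)
Definition growth : R := K * CU * (6 * d + 1)%:R * (2 * d + 1)%:R * 2.

Lemma growth_ge0 : 0 <= growth.
Proof. by rewrite /growth !mulr_ge0 // ?(ltW K0) // (le_trans ler01). Qed.

(* [sg] is a direction of time, [1] or [-1]. *)
Lemma energy_gronwall x (t0 T sg r M N : R) : X0 K U x -> `|sg| = 1 -> 0 <= r ->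
  (forall s, 0 <= s <= T -> forall k,
     energy U (Phi (t0 + sg * s) x) k <= N * logw r (sdist k (origin d))) ->
  (forall k, energy U (Phi t0 x) k <= M * logw r (sdist k (origin d))) ->
  forall s, 0 <= s <= T -> forall k,
     energy U (Phi (t0 + sg * s) x) k
       <= M * logw r (sdist k (origin d)) * expR (s * growth).
Proof.
move=> x0 sg1 r0 hN hM s sT k.
pose L k := logw r (sdist k (origin d)).
have L1 j : 1 <= L j by apply: logw_ge1.
have E1 t j : `|energy U (Phi t x) j| = energy U (Phi t x) j.
  by rewrite ger0_norm // (le_trans ler01) // energy_ge1.
have M0 : 0 <= M.
  rewrite -(pmulr_lge0 _ (lt_le_trans ltr01 (L1 k))).
  by apply: le_trans (hM k); rewrite (le_trans ler01) // energy_ge1.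
have N0 : 0 <= N.
  rewrite -(pmulr_lge0 _ (lt_le_trans ltr01 (L1 k))).
  by apply: le_trans (hN s sT k); rewrite (le_trans ler01) // energy_ge1.
pose c0 := K * CU * (6 * d + 1)%:R.
have c00 : 0 <= c0 by rewrite /c0 !mulr_ge0 // ?(ltW K0) // (le_trans ler01).
have gE : growth = c0 * ((2 * d + 1)%:R * 2) by rewrite /growth /c0 !mulrA.
(* The same weights serve twice: rate [growth] for the bound to be proved, and rate [2 * growth] for
   the a priori class, where the doubled coupling has to be absorbed. *)
have := @lattice_comparison R (site d) unit (@nb d)
  (fun k _ s => energy U (Phi (t0 + sg * s) x) k)
  (fun k _ s => power (Phi (t0 + sg * s) x) k * sg)
  (fun=> c0) T N (fun k => M * L k) (fun=> growth) L (fun=> 2 * growth).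
have super (a : R) j : 0 <= a -> c0 * \sum_(l <- nb j) (L l * a) <= growth * (L j * a).
  move=> a0; rewrite -mulr_suml !mulrA; apply: ler_wpM2r => //.
  rewrite gE -(mulrA c0); apply: ler_wpM2l => //.
  by rewrite -(mulrA _ 2); exact: sum_nb_logw.
move=> /(_ _ _ _ _ _ _ _ k tt s sT); rewrite E1; apply.
- move=> j _ r1 _; apply: is_derive1_comp (is_derive_energy _ _ x0) _.
  have := is_deriveD (is_derive_cst t0 r1 (1 : R)) (is_deriveZ sg (is_derive_id r1 (1 : R))).
  by have -> : (0 : R) + sg *: (1 : R) = sg by rewrite add0r; exact: mulr1.
- move=> j _ r1 w _ hw; rewrite normrM sg1 mulr1; apply: le_trans (power_bound _ _) _.
  apply: ler_wpM2l => //; apply: ler_sum => l _.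
  by have := hw l tt; rewrite E1.
- move=> j r1 _; rewrite (eq_bigr (fun l => L l * (M * expR (r1 * growth)))) => [|l _].
    apply: le_trans (super _ _ _) _; first by rewrite mulr_ge0 ?expR_ge0.
    by rewrite (mulrCA (L j) M) (mulrA M (L j)).
  by rewrite (mulrC M) -(mulrA (L l)).
- by move=> j r1 _; rewrite -(mulrA 2); apply: ler_wpM2l; rewrite ?super ?expR_ge0.
- by move=> j; rewrite (le_trans ler01).
- by move=> j _; rewrite mulr0 addr0 E1.
- move=> j _ r1 r1T; rewrite E1; apply: le_trans (hN _ r1T j) _.
  apply: ler_wpM2l => //; rewrite ler_peMr ?(le_trans ler01 (L1 j))//.
  rewrite (le_trans _ (expR_ge1Dx _))// lerDl; case/andP: r1T => r10 _.
  by rewrite mulr_ge0 // mulr_ge0 // growth_ge0.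
Qed.

End Energy.

(** * Cubes and the space [X0] *)

Lemma cube_pt_center d (nu : site d) k (h : (k < 2 * k + 1)%N) :
  cube_pt nu [ffun=> Ordinal h] = nu.
Proof. by apply/ffunP => l; rewrite !ffunE /= addrK. Qed.

Lemma cube_pt_inj d (nu : site d) k : injective (@cube_pt d nu k).
Proof.
move=> o o' /ffunP h; apply/ffunP => l; have := h l; rewrite !ffunE.
by move=> /addIr /addrI [] /val_inj.
Qed.

Lemma sum_cube_pt_eq_le1 (R : numDomainType) d (nu i : site d) k :
  \sum_(o : {ffun 'I_d -> 'I_(2 * k + 1)}) (cube_pt nu o == i)%:R <= 1 :> R.
Proof.
have [ex|no] := pselect (exists w : {ffun 'I_d -> 'I_(2 * k + 1)}, cube_pt nu w == i).
  have [w /eqP wi] := ex.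
  rewrite (bigD1 w) //= wi eqxx big1 ?addr0 // => w' w'w.
  by rewrite -wi (inj_eq (@cube_pt_inj _ _ _)) (negPf w'w).
rewrite big1 => [|w _]; first exact: ler01.
by case: eqP => // e; case: no; exists w; apply/eqP.
Qed.

Lemma card_cube d k : #|{ffun 'I_d -> 'I_(2 * k + 1)}| = ((2 * k + 1) ^ d)%N.
Proof. by rewrite card_ffun !card_ord. Qed.

Section ConfigX0.
Context (R : realType) (d : nat) (K : R) (U : {poly R}).
Hypotheses (d0 : (0 < d)%N) (K0 : 0 < K) (U0 : forall r : R, 0 <= U.[r]).

Lemma pair_energy_ge0 (nu : site d) k (x : config R d) (o : {ffun 'I_d -> 'I_(2 * k + 1)}) :
  0 <= \sum_(o' : {ffun 'I_d -> 'I_(2 * k + 1)} | sdist (cube_pt nu o') (cube_pt nu o) == 1%N)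
       K / 4 * ((x (cube_pt nu o)).1 - (x (cube_pt nu o')).1) ^+ 2.
Proof.
by apply: sumr_ge0 => o' _; rewrite mulr_ge0 ?sqr_ge0// divr_ge0// ltW.
Qed.

Lemma energy_le_Wloc (nu : site d) k (x : config R d) : energy U x nu <= Wloc K U nu k x.
Proof.
have h : (k < 2 * k + 1)%N by rewrite addn1 ltnS mul2n -addnn leq_addr.
rewrite /Wloc (bigD1 [ffun=> Ordinal h]) //= cube_pt_center -/(energy U x nu) -addrA lerDl.
apply: addr_ge0; last by apply: sumr_ge0 => o _; exact: pair_energy_ge0.
by apply: sumr_ge0 => o _; rewrite (le_trans ler01)// energy_ge1.
Qed.

Lemma X0P (x : config R d) : X0 K U x <-> exists M, forall nu k,
  logw (0 : R) (sdist nu (origin d)) `^ d%:R^-1 < k%:R ->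
  Wloc K U nu k x / ((2 * k + 1) ^ d)%:R <= M.
Proof.
split=> [x0|[M hM]].
  have [M hM] : exists M : R, (Qfun K U x <= M%:E)%E.
    move: x0; rewrite /X0 /=; case: (Qfun K U x) => [r _|//|_]; first by exists r.
    by exists 0; rewrite leNye.
  exists M => nu k hk; rewrite -lee_fin; apply: le_trans hM.
  by apply: ereal_sup_ubound; exists nu, k; split=> //; move: hk; rewrite /logw addr0.
apply: (@le_lt_trans _ _ M%:E); last exact: ltry.
apply: ge_ereal_sup => _ [nu [k [hk ->]]]; rewrite lee_fin; apply: hM.
by move: hk; rewrite /logw addr0.
Qed.

(** With L the weight and z = L^(1/d) >= 1, the smallest admissible cube has k <= z + 1, hence side
    at most 5 z and volume at most 5^d L. Its total energy dominates the energy at the centre. *)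
Lemma energy_le_logw (x : config R d) : X0 K U x ->
  exists M, forall k, energy U x k <= M * logw 0 (sdist k (origin d)).
Proof.
move=> /X0P[M hM].
exists (`|M| * 5 ^+ d) => nu; set L := logw _ _.
have L1 : 1 <= L by apply: logw_ge1.
set z := L `^ d%:R^-1 in hM *.
have z1 : 1 <= z by rewrite /z -[leLHS](powRr0 L) ler_powR // invr_ge0.
have zd : z ^+ d = L.
  rewrite -powR_mulrn ?powR_ge0 // /z -powRrM mulVf ?pnatr_eq0 -?lt0n //.
  by rewrite powRr1 // (le_trans ler01).
pose k := (Num.truncn z).+1.
have /andP[kz1 kz2] : (k.-1%:R <= z) && (z < k%:R).
  by rewrite /k; apply: truncn_itv; rewrite (le_trans ler01).
have {}kz1 : (k%:R : R) <= z + 1 by rewrite -[k]/(k.-1.+1) -natr1 lerD2r.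
have := hM nu k kz2; rewrite ler_pdivrMr ?ltr0n ?expn_gt0 ?addn1 // => hW.
apply: le_trans (energy_le_Wloc nu k x) _; apply: le_trans hW _.
apply: le_trans (ler_wpM2r _ (ler_norm M)) _; first exact: ler0n.
rewrite -mulrA; apply: ler_wpM2l => //; rewrite -zd -exprMn natrX.
by apply: lerXn2r; rewrite ?nnegrE ?mulr_ge0 ?(le_trans ler01 z1)// -natr1 natrM; lra.
Qed.

(** Only finiteness of [Qfun] after a change at one site is at stake, so losing a factor 2 and a
    multiple of the volume is harmless; the latter lets the pairs involving [i] be counted without
    regard to adjacency. *)
Lemma Wloc_upd (x : config R d) i (a : R * R) nu k :
  Wloc K U nu k (upd x i a) <= 2 * Wloc K U nu k x
   + (a.2 ^+ 2 / 2 + U.[a.1] + 1 + 2 * K * (a.1 - (x i).1) ^+ 2) * ((2 * k + 1) ^ d)%:R.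
Proof.
set y := upd x i a; set D := a.1 - (x i).1; set A := a.2 ^+ 2 / 2 + U.[a.1] + 1.
pose N : R := ((2 * k + 1) ^ d)%:R.
pose ind (o : {ffun 'I_d -> 'I_(2 * k + 1)}) : R := (cube_pt nu o == i)%:R.
have K4 : 0 <= K / 4 by rewrite divr_ge0 // ltW.
have sumN (c : R) : \sum_(o : {ffun 'I_d -> 'I_(2 * k + 1)}) c = N * c.
  by rewrite sumr_const card_cube -mulr_natl.
have A0 : 0 <= A by rewrite /A !addr_ge0 ?divr_ge0 ?sqr_ge0.
have s1 : \sum_(o : {ffun 'I_d -> 'I_(2 * k + 1)}) energy U y (cube_pt nu o)
   <= \sum_(o : {ffun 'I_d -> 'I_(2 * k + 1)}) energy U x (cube_pt nu o) + N * A.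
  rewrite -sumN -big_split /=; apply: ler_sum => o _; rewrite /energy /y /upd.
  case: eqP => _; rewrite ?lerDl // -/A lerDr.
  by rewrite (le_trans ler01)// energy_ge1.
have ind1 : \sum_o ind o <= 1 by apply: sum_cube_pt_eq_le1.
have s2 : \sum_(o : {ffun 'I_d -> 'I_(2 * k + 1)})
     \sum_(o' : {ffun 'I_d -> 'I_(2 * k + 1)} | sdist (cube_pt nu o') (cube_pt nu o) == 1%N)
       K / 4 * ((y (cube_pt nu o)).1 - (y (cube_pt nu o')).1) ^+ 2
   <= 2 * \sum_(o : {ffun 'I_d -> 'I_(2 * k + 1)})
     \sum_(o' : {ffun 'I_d -> 'I_(2 * k + 1)} | sdist (cube_pt nu o') (cube_pt nu o) == 1%N)
       K / 4 * ((x (cube_pt nu o)).1 - (x (cube_pt nu o')).1) ^+ 2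
     + N * (2 * K * D ^+ 2).
  have yE o : (y (cube_pt nu o)).1 = (x (cube_pt nu o)).1 + D * ind o.
    rewrite /y /upd /ind; case: eqP => [->|_] /=; last by rewrite mulr0 addr0.
    by rewrite mulr1 /D addrC subrK.
  apply: (@le_trans _ _ (\sum_(o : {ffun 'I_d -> 'I_(2 * k + 1)})
     (2 * \sum_(o' : {ffun 'I_d -> 'I_(2 * k + 1)} | sdist (cube_pt nu o') (cube_pt nu o) == 1%N)
       K / 4 * ((x (cube_pt nu o)).1 - (x (cube_pt nu o')).1) ^+ 2 +
      K * D ^+ 2 * (N * ind o + 1)))).
    apply: ler_sum => o _.
    apply: (@le_trans _ _ (\sum_(o' : {ffun 'I_d -> 'I_(2 * k + 1)} |
        sdist (cube_pt nu o') (cube_pt nu o) == 1%N)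
        (2 * (K / 4 * ((x (cube_pt nu o)).1 - (x (cube_pt nu o')).1) ^+ 2) +
         K * D ^+ 2 * (ind o + ind o')))).
      apply: ler_sum => o' _; rewrite !yE.
      have i01 w : ind w ^+ 2 = ind w by rewrite /ind; case: eqP; rewrite ?expr1n ?expr0n.
      have e1 := i01 o; have e2 := i01 o'.
      set q := (x _).1; set q' := (x _).1.
      rewrite -{2}e1 -{2}e2.
      (* Two parallelogram identities: the difference of the two sides is K/4 times the first of
         these squares plus K/2 times the second. *)
      have h0 := sqr_ge0 (q - q' - D * ind o + D * ind o').
      have h1 := sqr_ge0 (D * ind o + D * ind o').
      rewrite -subr_ge0.
      apply: le_trans (addr_ge0 (mulr_ge0 K4 h0) (mulr_ge0 (mulr_ge0 (ler0n R 2) K4) h1)) _.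
      by rewrite le_eqVlt; apply/orP; left; apply/eqP; field.
    rewrite big_split /= -mulr_sumr lerD2l -mulr_sumr; apply: ler_wpM2l.
      by rewrite mulr_ge0 ?sqr_ge0 // ltW.
    have ind0 w : 0 <= ind w by exact: ler0n.
    apply: (@le_trans _ _ (\sum_(o' : {ffun 'I_d -> 'I_(2 * k + 1)}) (ind o + ind o'))).
      rewrite [leRHS](bigID (fun o' => sdist (cube_pt nu o') (cube_pt nu o) == 1%N)) /=.
      by rewrite lerDl; apply: sumr_ge0 => o' _; rewrite addr_ge0.
    by rewrite big_split /= sumN lerD2l.
  rewrite big_split /= -mulr_sumr lerD2l -mulr_sumr big_split /= sumN mulr1 -mulr_sumr.
  have KD : 0 <= K * D ^+ 2 by rewrite mulr_ge0 ?sqr_ge0 // ltW.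
  have N0 : 0 <= N by exact: ler0n.
  have := ler_wpM2l N0 ind1 => h.
  have := ler_wpM2l KD (_ : N * \sum_o ind o + N <= 2 * N).
  by move=> /(_ _) H; apply: le_trans (H _) _; lra.
rewrite /Wloc.
have S0 : 0 <= \sum_(o : {ffun 'I_d -> 'I_(2 * k + 1)}) energy U x (cube_pt nu o).
  by apply: sumr_ge0 => o _; rewrite (le_trans ler01)// energy_ge1.
rewrite -/N; move: s1 s2 S0; rewrite /energy; lra.
Qed.

Lemma X0_upd (x : config R d) i a : X0 K U x -> X0 K U (upd x i a).
Proof.
move=> /X0P[M hM]; apply/X0P.
exists (2 * M + (a.2 ^+ 2 / 2 + U.[a.1] + 1 + 2 * K * (a.1 - (x i).1) ^+ 2)) => nu k hk.
have N0 : 0 < ((2 * k + 1) ^ d)%:R :> R by rewrite ltr0n expn_gt0 addn1.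
have := hM nu k hk; rewrite !ler_pdivrMr // => h.
by apply: le_trans (Wloc_upd _ _ _ _ _) _; lra.
Qed.

Context (CU : R).
Hypotheses (CU1 : 1 <= CU) (hCU : forall q, 1 + q ^+ 4 <= CU * (U.[q] + 1)).
Context (Phi : R -> config R d -> config R d).
Hypothesis flow : is_flow K U Phi.

(** In the Baire argument, [energy_le_logw] at each [Phi s x] gives pointwise finiteness, and
    [energy_gronwall], run forward or backward in time, gives the quantitative propagation. *)
Lemma energy_locally_bounded x T : X0 K U x -> exists N, forall s, 0 <= s <= T ->
  forall k, energy U (Phi s x) k <= N * logw 0 (sdist k (origin d)).
Proof.
move=> x0; pose c := growth d K CU.
have c0 : 0 <= c by apply: growth_ge0.
apply: (@bounded_of_pointwise_bounded R (site d) (fun k s => energy U (Phi s x) k)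
  (fun k => logw 0 (sdist k (origin d))) (expR (`|T| * c)) 0 T).
- by move=> k; rewrite (le_trans ler01) // logw_ge1.
- by rewrite (le_trans _ (expR_ge1Dx _)) // lerDl mulr_ge0.
- move=> k s; apply: differentiable_continuous; apply/derivable1_diffP.
  by have [] := is_derive_energy flow k s x0.
- move=> a b M s s' a0 bT [N hN] /andP[as_ sb] /andP[as' s'b] hM k.
  pose sg : R := if s <= s' then 1 else -1.
  have sg1 : `|sg| = 1 by rewrite /sg; case: ifP; rewrite ?normrN normr1.
  have E : s' = s + sg * `|s' - s|.
    rewrite /sg; case: (leP s s') => h; first by rewrite mul1r ger0_norm ?subr_ge0//; lra.
    by rewrite ltr0_norm ?subr_lt0//; lra.
  have M0 : 0 <= M * logw 0 (sdist k (origin d)).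
    by apply: le_trans (hM k); rewrite (le_trans ler01) // energy_ge1.
  rewrite [X in Phi X]E.
  apply: le_trans (@energy_gronwall R d K U K0 U0 CU CU1 hCU Phi flow x s `|s' - s| sg
    0 M N x0 sg1 (lexx _) _ hM _ _ k) _.
  + move=> r /andP[r0 rs] j; apply: hN.
    move: rs; rewrite /sg; case: (leP s s') => h.
      by rewrite mul1r ger0_norm ?subr_ge0//; lra.
    by rewrite ltr0_norm ?subr_lt0//; lra.
  + by rewrite normr_ge0 lexx.
  + rewrite mulrC -(mulrA _ M); apply: ler_wpM2r => //; rewrite ler_expR.
    apply: ler_wpM2r => //; rewrite [leRHS]ger0_norm; last lra.
    by rewrite ler_norml; lra.
- move=> s; have [h _ _ _ _] := flow.
  exact: energy_le_logw (h s x x0).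
Qed.

End ConfigX0.

(** * Propagation of perturbations *)

(* The comparison functions are [exp (Lam s + (rho + s / T) |k - i|)]: letting the
   spatial rate vary with time produces the gain [|k - i| / T] that absorbs couplings
   [c k] growing with the distance. *)
Lemma perturbation_growth (R : realType) d (i : site d) (u u' : site d -> bool -> R -> R)
  (c : site d -> R) (T eta M Lam theta : R) :
  0 < T -> 0 <= theta -> (forall k, 0 <= c k) ->
  (forall k g s, 0 <= s <= T -> is_derive s (1 : R) (u k g) (u' k g s)) ->
  (forall k g s (w : site d -> R), 0 <= s <= T -> (forall j g', `|u j g' s| <= w j) ->
     `|u' k g s| <= c k * \sum_(j <- nb k) w j) ->
  (forall k, 2 * (2 * d + 1)%:R * expR (theta + 2) * c k <= Lam + (sdist k i)%:R / T) ->
  (forall k g, `|u k g 0| <= eta * (k == i)%:R) ->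
  (forall k g s, 0 <= s <= T -> `|u k g s| <= M * expR (sdist k i)%:R) ->
  forall k g s, 0 <= s <= T -> `|u k g s| <= eta * expR (Lam * T - theta * (sdist k i)%:R).
Proof.
move=> T0 th0 c0 du hu hc u0 ap k g s sT.
pose m k : R := (sdist k i)%:R.
have eta0 : 0 <= eta.
  by have := u0 i g; rewrite eqxx mulr1; apply: le_trans.
have Lam0 : 0 <= Lam.
  by have := hc i; rewrite sdistxx mul0r addr0; apply: le_trans; rewrite !mulr_ge0 ?expR_ge0.
have b0 j : 0 <= Lam + m j / T by rewrite addr_ge0 // divr_ge0 // ltW.
(* The spatial rate at time [r] is [rho + r / T], of modulus at most [theta + 2]. Neighbouring
   values of the comparison function thus differ at most by the factor [expR (theta + 2)], and the
   hypothesis on [c] absorbs it. *)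
have sup rho r j : 0 <= r <= T -> `|rho| <= theta + 1 ->
    2 * (c j * \sum_(l <- nb j) expR (rho * m l) * expR (r * (Lam + m l / T)))
    <= (Lam + m j / T) * (expR (rho * m j) * expR (r * (Lam + m j / T))).
  move=> /andP[r0 rT] hrho; set X := expR (rho * m j) * _.
  have h : \sum_(l <- nb j) expR (rho * m l) * expR (r * (Lam + m l / T))
      <= (2 * d + 1)%:R * (expR (theta + 2) * X).
    apply: sum_nb_le => l jl; rewrite /X -!expRD ler_expR.
    have rT1 : 0 <= r / T <= 1 by rewrite divr_ge0 ?(ltW T0)//= ler_pdivrMr // mul1r.
    have h1 : m l <= m j + 1 by rewrite /m natr1 ler_nat sdist_near.
    have h2 : m j <= m l + 1 by rewrite /m natr1 ler_nat sdist_near // sdistC.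
    have ml0 : 0 <= m l by exact: ler0n.
    have -> : r * (Lam + m l / T) = r * Lam + r / T * m l by ring.
    have -> : r * (Lam + m j / T) = r * Lam + r / T * m j by ring.
    move: rT1 hrho; set q := r / T => /andP[q0 q1]; rewrite ler_norml => /andP[r1 r2].
    have h3 : `|(rho + q) * (m l - m j)| <= theta + 2.
      rewrite normrM -[leRHS]mulr1; apply: ler_pM => //; rewrite ler_norml; lra.
    by move: h3; rewrite ler_norml => /andP[_]; lra.
  have X0 : 0 <= X by rewrite mulr_ge0 ?expR_ge0.
  apply: le_trans (ler_wpM2r X0 (hc j)).
  have -> : 2 * (2 * d + 1)%:R * expR (theta + 2) * c j * X =
    2 * (c j * ((2 * d + 1)%:R * (expR (theta + 2) * X))) by ring.
  by do 2! (apply: ler_wpM2l => //).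
(* Starting from the rate [- (theta + 1)], the drift [s / T <= 1] still leaves decay at rate [theta]
   at the final time. The rate [1] in the a priori class matches the exponential growth allowed by
   the last hypothesis. *)
have comp := @lattice_comparison R (site d) bool (@nb d) u u' c T M
  (fun k => eta * expR (- (theta + 1) * m k)) (fun k => Lam + m k / T)
  (fun k => expR (1 * m k)) (fun k => Lam + m k / T) du hu.
apply: le_trans (comp _ _ _ _ _ k g s sT) _.
- move=> j r rT.
  have := sup (- (theta + 1)) r j rT; rewrite normrN ger0_norm ?addr_ge0 // => /(_ (lexx _)).
  set S := \sum_(l <- _) _; set X := expR _ * expR _ => h.
  have -> : \sum_(l <- nb j) eta * expR (- (theta + 1) * m l) * expR (r * (Lam + m l / T))
     = eta * S by rewrite /S mulr_sumr; apply: eq_bigr => l _; rewrite mulrA.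
  have S0 : 0 <= c j * S.
    by rewrite mulr_ge0 // sumr_ge0 // => l _; rewrite mulr_ge0 ?expR_ge0.
  rewrite -(mulrA eta) -/X mulrCA [leRHS]mulrCA; apply: ler_wpM2l => //; lra.
- by move=> j r rT; apply: sup => //; rewrite normr1; lra.
- by move=> j; exact: expR_ge0.
- move=> j g'; apply: le_trans (u0 j g') _; apply: ler_wpM2l => //.
  by case: eqP => [->|_]; rewrite ?expR_ge0 // /m sdistxx mulr0 expR0.
- move=> j g' r rT; have [r0 _] := andP rT; apply: le_trans (ap j g' r rT) _.
  have M0 : 0 <= M.
    by rewrite -(pmulr_lge0 _ (expR_gt0 (sdist j i)%:R)); apply: le_trans (ap j g' r rT).
  apply: ler_wpM2l => //; rewrite mul1r ler_peMr ?expR_ge0 //.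
  by rewrite (le_trans _ (expR_ge1Dx _)) // lerDl mulr_ge0.
have [s0 sT'] := andP sT.
rewrite -mulrA -expRD; apply: ler_wpM2l => //; rewrite ler_expR -/(m k).
have m0 : 0 <= m k by exact: ler0n.
have -> : s * (Lam + m k / T) = s * Lam + s / T * m k by ring.
have q1 : s / T <= 1 by rewrite ler_pdivrMr // mul1r.
have := ler_wpM2r m0 q1; have := ler_wpM2r Lam0 sT'.
by set q := s / T * m k; lra.
Qed.

(** With z the logarithm, c z <= sg z^2 / 2 + c^2 / (2 sg), and z^2 / 2 <= exp z returns the
    argument of the logarithm. *)
Lemma log_sublinear (R : realType) (r c sg : R) : 0 <= r -> 0 < sg ->
  exists Lam, forall m, c * logw r m <= Lam + m%:R * sg.
Proof.
move=> r0 s0; exists (sg * (expR 1 + r) + c ^+ 2 / (2 * sg)) => m.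
set z := logw r m.
have z1 : 1 <= z by apply: logw_ge1.
have h : z ^+ 2 / 2 <= expR 1 + r + m%:R.
  have -> : expR 1 + r + m%:R = expR z.
    by rewrite /z /logw lnK // posrE; have := expR_gt0 (1 : R); have := ler0n R m; lra.
  apply: le_trans (expR_ge1Dxn 1 (le_trans ler01 z1)).
  by rewrite -[2`!]/2%N lerDr.
have := ler_wpM2l (ltW s0) h.
have h2 : 0 <= sg / 2 * (z - c / sg) ^+ 2 by rewrite mulr_ge0 ?sqr_ge0 // divr_ge0 // ltW.
have e : sg / 2 * (z - c / sg) ^+ 2 = sg * (z ^+ 2 / 2) - c * z + c ^+ 2 / (2 * sg).
  by field; rewrite gt_eqF.
by rewrite e in h2; lra.
Qed.

Lemma logw_le_exp (R : realType) (r : R) m : 0 <= r ->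
  logw r m <= (expR 1 + r) * expR m%:R.
Proof.
move=> r0; have h0 := ler0n R m; have h1 := expR_ge1Dx (m%:R : R); have h2 := @expR1_ge2 R.
have h3 : expR (logw r m) = expR 1 + r + m%:R by rewrite /logw lnK // posrE; lra.
have := expR_ge1Dx (logw r m); rewrite h3 => h4.
suff : expR 1 + r + m%:R <= (expR 1 + r) * expR m%:R by lra.
by nra.
Qed.

Lemma logw_recenter (R : realType) (r : R) d (k i o : site d) : 0 <= r ->
  logw r (sdist k o) <= logw (r + (sdist i o)%:R) (sdist k i).
Proof.
move=> r0; have := expR_gt0 (1 : R); have h0 := ler0n R (sdist k o); have h1 := ler0n R (sdist i o).
have h2 := ler0n R (sdist k i) => e0.
have : ((sdist k o)%:R : R) <= (sdist k i)%:R + (sdist i o)%:R.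
  by rewrite -natrD ler_nat sdist_triangle.
by rewrite /logw ler_ln ?posrE; lra.
Qed.

(** The passage from finite differences to derivatives: a Lipschitz estimate based at the single
    point [v0] is enough. *)
Lemma norm_diff_le (R : realType) (V W : normedModType R) (F : V -> W) (v0 u : V) (L : R) :
  differentiable F v0 -> (\forall a \near v0, `|F a - F v0| <= L * `|a - v0|) ->
  `|'d F v0 u| <= L * `|u|.
Proof.
move=> dF hF; rewrite -deriveE //.
have /cvg_norm : (fun h : R => h^-1 *: ((F \o shift v0) (h *: u) - F v0)) @ 0^' --> 'D_u F v0.
  by have := @diff_derivable _ _ _ F v0 u dF.
move=> /cvgr_to_le; apply.
have h1 : (fun h : R => h *: u + v0) @ 0^' --> v0.
  rewrite -[X in _ --> X]add0r; apply: cvgD; last exact: cvg_cst.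
  rewrite -[X in _ --> X](scale0r u); apply: cvgZr_tmp.
  exact: nbhs_dnbhs.
have h2 : \forall h \near (0 : R)^', `|F (h *: u + v0) - F v0| <= L * `|h *: u + v0 - v0|.
  exact: h1 _ hF.
near=> h.
have hn0 : h != 0 by near: h; exact: nbhs_dnbhs_neq.
rewrite /= normrZ normfV ler_pdivrMl ?normr_gt0//.
have -> : `|h| * (L * `|u|) = L * `|h *: u + v0 - v0| by rewrite addrK normrZ mulrCA.
by near: h.
Unshelve. all: by end_near. Qed.

Section Perturbation.
Context (R : realType) (d : nat) (K : R) (U : {poly R}).
Hypotheses (d0 : (0 < d)%N) (K0 : 0 < K) (U0 : forall r : R, 0 <= U.[r]).
Context (CU CL : R).
Hypotheses (CU1 : 1 <= CU) (hCU : forall q, 1 + q ^+ 4 <= CU * (U.[q] + 1)).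
Hypotheses (CL0 : 0 <= CL) (hCL : forall a b,
  `|U^`().[a] - U^`().[b]| <= CL * (1 + a ^+ 2 + b ^+ 2) * `|a - b|).
Context (Phi : R -> config R d -> config R d).
Hypothesis flow : is_flow K U Phi.

Lemma norm_le_energy (x : config R d) k : `|x k| <= 2 * CU * energy U x k.
Proof.
have := energy_q2 CU1 hCU x k; have := energy_p2 U0 x k; have e1 := energy_ge1 U0 x k.
have h : energy U x k <= CU * energy U x k by rewrite ler_peMl// (le_trans ler01).
have c0 : 0 <= CU * energy U x k by apply: le_trans h; lra.
move: h c0; rewrite -mulrA; set E := CU * _ => h c0 hp hq.
rewrite prod_normE ge_max !ler_norml.
have := sqr_ge0 ((x k).1 - 1); have := sqr_ge0 ((x k).1 + 1).
have := sqr_ge0 ((x k).2 - 1); have := sqr_ge0 ((x k).2 + 1).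
move: hp hq; set q := (x k).1; set p := (x k).2; set e := energy U x k in h e1 *.
by move=> hp hq h1 h2 h3 h4; apply/andP; split; apply/andP; split; lra.
Qed.

(** Bounds the linear system solved by a difference of two trajectories: 1 for the equation of the
    positions, the middle term for the difference quotient of U', the last for the 2d springs at a
    site and the neighbours' own displacements. *)
Definition coupling (q q' : R) : R := 1 + CL * (1 + q ^+ 2 + q' ^+ 2) + (2 * d + 1)%:R * K.

Lemma coupling_ge1 q q' : 1 <= coupling q q'.
Proof.
rewrite /coupling -addrA lerDl addr_ge0 // mulr_ge0 ?(ltW K0) //.
by rewrite !addr_ge0 ?sqr_ge0.
Qed.

Lemma flow_perturbation x i a (T M Lam theta : R) (c : site d -> R) :
  X0 K U x -> 0 < T -> 0 <= theta ->
  (forall s, 0 <= s <= T -> forall k,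
     coupling (Phi s (upd x i a) k).1 (Phi s x k).1 <= c k) ->
  (forall k, 2 * (2 * d + 1)%:R * expR (theta + 2) * c k <= Lam + (sdist k i)%:R / T) ->
  (forall s, 0 <= s <= T -> forall k,
     `|Phi s (upd x i a) k - Phi s x k| <= M * expR (sdist k i)%:R) ->
  forall s, 0 <= s <= T -> forall k,
    `|Phi s (upd x i a) k - Phi s x k| <= `|a - x i| * expR (Lam * T - theta * (sdist k i)%:R).
Proof.
move=> x0 T0 th0 hc hLam ap.
set y := upd x i a.
have y0 : X0 K U y by apply: X0_upd.
have [_ Phi0 _ Phid _] := flow.
(* [true] labels the position component, [false] the momentum component. *)
pose u k (g : bool) s := if g then (Phi s y k).1 - (Phi s x k).1 else (Phi s y k).2 - (Phi s x k).2.
pose F z s k := - (U^`()).[(Phi s z k).1] - K * \sum_(j <- nbrs k) ((Phi s z k).1 - (Phi s z j).1).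
pose u' k (g : bool) s := if g then (Phi s y k).2 - (Phi s x k).2 else F y s k - F x s k.
have normE s k : `|Phi s y k - Phi s x k| = Num.max `|u k true s| `|u k false s|.
  by rewrite prod_normE.
have key k g s : 0 <= s <= T ->
    `|u k g s| <= `|a - x i| * expR (Lam * T - theta * (sdist k i)%:R).
  move: k g s; apply: (@perturbation_growth R d i u u' c T `|a - x i| M Lam theta) => //.
  - by move=> k; apply: le_trans (hc 0 _ k); rewrite ?(le_trans ler01 (coupling_ge1 _ _)) // lexx ltW.
  - move=> k [] s _ /=.
      by have [h1 _] := Phid _ y0 k s; have [h2 _] := Phid _ x0 k s; exact: is_deriveB h1 h2.
    by have [_ h1] := Phid _ y0 k s; have [_ h2] := Phid _ x0 k s; exact: is_deriveB h1 h2.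
  - move=> k g s w sT hw.
    have w0 j : 0 <= w j by apply: le_trans (hw j true).
    have S0 : 0 <= \sum_(j <- nbrs k) w j by apply: sumr_ge0.
    have hck := hc s sT k; have c1 := coupling_ge1 (Phi s y k).1 (Phi s x k).1.
    rewrite big_cons; case: g => /=.
      apply: le_trans (hw k false) _.
      have : 1 * (w k + \sum_(j <- nbrs k) w j) <= c k * (w k + \sum_(j <- nbrs k) w j).
        by apply: ler_wpM2r; [rewrite addr_ge0|exact: le_trans hck].
      by lra.
    apply: le_trans (ler_wpM2r _ hck); last by rewrite addr_ge0.
    have eqF : F y s k - F x s k = - ((U^`()).[(Phi s y k).1] - (U^`()).[(Phi s x k).1])
        - K * \sum_(j <- nbrs k) (u k true s - u j true s).
      rewrite /F; have -> : \sum_(j <- nbrs k) (u k true s - u j true s) =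
         \sum_(j <- nbrs k) ((Phi s y k).1 - (Phi s y j).1)
         - \sum_(j <- nbrs k) ((Phi s x k).1 - (Phi s x j).1).
        by rewrite -sumrB; apply: eq_bigr => j _; rewrite /u; ring.
      by ring.
    rewrite eqF; apply: le_trans (ler_normB _ _) _; rewrite normrN normrM (gtr0_norm K0).
    have h1 : `|\sum_(j <- nbrs k) (u k true s - u j true s)|
         <= 2 * d%:R * w k + \sum_(j <- nbrs k) w j.
      apply: le_trans (ler_norm_sum _ _ _) _.
      apply: (@le_trans _ _ (\sum_(j <- nbrs k) (w k + w j))).
        apply: ler_sum => j _; apply: le_trans (ler_normB _ _) _.
        by apply: lerD; exact: hw.
      rewrite big_split /= lerD2r big_const_seq iter_addr_0 count_predT size_nbrs.
      by rewrite -(mulr_natl _ (2 * d)) natrM.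
    have h2 := hCL (Phi s y k).1 (Phi s x k).1.
    have h3 := hw k true; rewrite -/(u k true s) in h2.
    move: h2; set A := CL * _ => h2.
    have A0 : 0 <= A by rewrite /A mulr_ge0 // !addr_ge0 ?sqr_ge0.
    have h4 := ler_wpM2l A0 h3; have h5 := ler_wpM2l (ltW K0) h1.
    rewrite /coupling -/A natrD natrM.
    have dS : 0 <= d%:R * K * \sum_(j <- nbrs k) w j by rewrite !mulr_ge0 // ltW.
    have AS : 0 <= A * \sum_(j <- nbrs k) w j by rewrite mulr_ge0.
    have Kw : 0 <= K * w k by rewrite mulr_ge0 // ltW.
    move: (w0 k) S0 dS AS h5; set S := \sum_(j <- nbrs k) w j; set N := `|\sum_(j <- _) _|.
    by move=> w0' S0 dS AS h5; lra.
  - move=> k g; rewrite /u !Phi0 // /y /upd; case: eqP => [->|_]; last first.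
      by case: g; rewrite !subrr normr0 mulr0.
    rewrite mulr1 prod_normE.
    by case: g; rewrite le_max lexx ?orbT.
  - move=> k g s sT; apply: le_trans (ap s sT k); rewrite normE.
    by case: g; rewrite le_max lexx ?orbT.
by move=> s sT k; rewrite normE ge_max !key.
Qed.

(** The size of the constant is irrelevant, so the couplings may be bounded by the logarithm itself
    instead of its square root; [log_sublinear] with slope 1/T then supplies some [Lam], and
    [theta = 0] makes the result uniform in [k]. *)
Lemma flow_lipschitz x i T : X0 K U x -> 0 < T ->
  exists L, 0 < L /\ \forall a \near x i, forall s, 0 <= s <= T -> forall k,
    `|Phi s (upd x i a) k - Phi s x k| <= L * `|a - x i|.
Proof.
move=> x0 T0.
have Phi0x : (forall z, X0 K U z -> Phi 0 z = z) by case: flow.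
have [M hM] := energy_le_logw d0 K0 U0 x0.
pose g := growth d K CU.
have g0 : 0 <= g by apply: growth_ge0.
pose L k := logw (0 : R) (sdist k (origin d)).
have L1 k : 1 <= L k by apply: logw_ge1.
(* The margin 1 admits every [a] whose site energy exceeds that of [x i] by at most 1, so the same
   [S] controls both trajectories. *)
pose S := (M + 1) * expR (T * g).
have bnd z : X0 K U z -> (forall k, energy U z k <= (M + 1) * L k) ->
    forall s, 0 <= s <= T -> forall k, energy U (Phi s z) k <= S * L k.
  move=> z0 hz s sT k.
  have [N hN] := energy_locally_bounded d0 K0 U0 CU1 hCU flow T z0.
  have := @energy_gronwall R d K U K0 U0 CU CU1 hCU Phi flow z 0 T 1 0 (M + 1) N z0
    (normr1 _) (lexx _).
  rewrite Phi0x // => /(_ _ hz s sT k); rewrite add0r mul1r => H.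
  apply: le_trans (H _) _.
    by move=> r rT j; rewrite add0r mul1r; exact: hN.
  rewrite /S mulrAC -/(L k); apply: ler_wpM2r; first exact: le_trans ler01 (L1 k).
  apply: ler_wpM2l.
    rewrite -(pmulr_lge0 _ (lt_le_trans ltr01 (L1 k))).
    by apply: le_trans (hz k); rewrite (le_trans ler01) // energy_ge1.
  by rewrite ler_expR ler_wpM2r //; case/andP: sT.
have hx k : energy U x k <= (M + 1) * L k.
  by apply: le_trans (hM k) _; rewrite -/(L k) mulrDl mul1r lerDl (le_trans ler01) ?L1.
have S0 : 0 <= S.
  rewrite -(pmulr_lge0 _ (lt_le_trans ltr01 (L1 i))).
  apply: le_trans (bnd x x0 hx 0 _ i); first by rewrite (le_trans ler01) // energy_ge1.
  by rewrite lexx ltW.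
clearbody S.
pose c k := (1 + CL + 2 * CL * CU * S + (2 * d + 1)%:R * K) * L k.
pose r : R := (sdist i (origin d))%:R.
have r0 : 0 <= r by exact: ler0n.
have Ti : 0 < T^-1 by rewrite invr_gt0.
have [Lam hLam] := @log_sublinear R r (2 * (2 * d + 1)%:R * expR (0 + 2)
   * (1 + CL + 2 * CL * CU * S + (2 * d + 1)%:R * K)) T^-1 r0 Ti.
have Q0 : 0 <= 1 + CL + 2 * CL * CU * S + (2 * d + 1)%:R * K.
  have CU0 : 0 <= CU by apply: le_trans ler01 CU1.
  by apply: addr_ge0; [apply: addr_ge0; [exact: addr_ge0|rewrite !mulr_ge0]|
    rewrite mulr_ge0 // ltW].
exists (expR (Lam * T)); split; first exact: expR_gt0.
have cnear : \forall a \near x i, a.2 ^+ 2 / 2 + U.[a.1] + 1 < energy U x i + 1.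
  have ct : (fun a : R * R => a.2 ^+ 2 / 2 + U.[a.1] + 1) @ x i --> energy U x i.
    apply: cvgD; last exact: cvg_cst.
    apply: cvgD.
      apply: cvgM; last exact: cvg_cst.
      apply: (@cvg_comp _ _ _ (fun a : R * R => a.2) (fun p => p ^+ 2)).
        exact: cvg_snd.
      exact: exprn_continuous.
    apply: (@cvg_comp _ _ _ (fun a : R * R => a.1) (horner U)); first exact: cvg_fst.
    exact: continuous_horner.
  by apply: (@cvgr_lt _ _ _ _ _ _ ct); rewrite ltrDl.
near=> a => s sT k.
set y := upd x i a.
have y0 : X0 K U y by apply: X0_upd.
have hy j : energy U y j <= (M + 1) * L j.
  rewrite /energy /y /upd; case: eqP => [->|_]; last exact: hx.
  apply: (@le_trans _ _ (energy U x i + 1)); first by apply/ltW; near: a.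
  by rewrite mulrDl mul1r; apply: lerD; rewrite ?L1 ?hM.
have q2 z : X0 K U z -> (forall k, energy U z k <= (M + 1) * L k) ->
    forall s, 0 <= s <= T -> forall k, (Phi s z k).1 ^+ 2 <= CU * S * L k.
  move=> z0 hz r1 rT j; apply: le_trans (energy_q2 CU1 hCU _ _) _.
  rewrite -mulrA; apply: ler_wpM2l; first by rewrite (le_trans ler01).
  exact: bnd.
have := @flow_perturbation x i a T (4 * CU * S * (expR 1 + r)) Lam 0 c x0 T0 (lexx _).
move=> /(_ _ _ _ s sT k); rewrite mul0r subr0 [leRHS]mulrC; apply.
- move=> r1 rT j; have h1 := q2 x x0 hx r1 rT j; have h2 := q2 y y0 hy r1 rT j.
  rewrite /coupling /c -/y; have l1 := L1 j.
  have k0 : 0 <= (2 * d + 1)%:R * K by rewrite mulr_ge0 // ltW.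
  have h3 : CL * ((Phi r1 y j).1 ^+ 2 + (Phi r1 x j).1 ^+ 2) <= CL * (2 * (CU * S * L j)).
    by apply: ler_wpM2l => //; lra.
  have h4 : (1 + CL + (2 * d + 1)%:R * K) * 1 <= (1 + CL + (2 * d + 1)%:R * K) * L j.
    by apply: ler_wpM2l => //; rewrite !addr_ge0.
  move: h3 h4; set Z := (2 * d + 1)%:R * K; set V := CU * S * L j.
  have -> : (1 + CL + 2 * CL * CU * S + Z) * L j = (1 + CL + Z) * L j + CL * (2 * V).
    by rewrite /V; ring.
  by lra.
- move=> j; apply: le_trans (hLam (sdist j i)); rewrite /c mulrA.
  apply: ler_wpM2l.
    by apply: mulr_ge0 (Q0); rewrite !mulr_ge0 // expR_ge0.
  by rewrite /L /r -[X in logw X (sdist j i)]add0r; exact: logw_recenter.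
- move=> r1 rT j; apply: le_trans (ler_normB _ _) _.
  have n1 := norm_le_energy (Phi r1 y) j; have n2 := norm_le_energy (Phi r1 x) j.
  have b1 := bnd y y0 hy r1 rT j; have b2 := bnd x x0 hx r1 rT j.
  have CU0 : 0 <= 2 * CU by rewrite mulr_ge0 // (le_trans ler01).
  have lw : L j <= (expR 1 + r) * expR (sdist j i)%:R.
    apply: le_trans (logw_le_exp _ r0).
    by rewrite /L /r -[X in logw X (sdist j i)]add0r; exact: logw_recenter.
  have := ler_wpM2l CU0 b1; have := ler_wpM2l CU0 b2.
  have := ler_wpM2l (mulr_ge0 CU0 S0) lw.
  move: n1 n2; rewrite -/y.
  set E1 := energy _ _ _; set E2 := energy _ _ _.
  set n1 := `|_|; set n2 := `|_|; set lj := L j; set e := expR _; set e1 := expR _.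
  by move=> h1 h2 h3 h4 h5; lra.
Unshelve. all: by end_near. Qed.

(* The rough Lipschitz bound [flow_lipschitz] keeps the perturbed trajectory at distance
   at most [1] from the original one, so only the latter enters the coupling. *)
Lemma flow_diff_le x i (T Lam theta : R) (c : site d -> R) j u :
  X0 K U x -> 0 < T -> 0 <= theta ->
  (forall s, 0 <= s <= T -> forall k,
     coupling (`|(Phi s x k).1| + 1) (Phi s x k).1 <= c k) ->
  (forall k, 2 * (2 * d + 1)%:R * expR (theta + 2) * c k <= Lam + (sdist k i)%:R / T) ->
  `|'d (fun a => Phi T (upd x i a) j) (x i) u| <= expR (Lam * T - theta * (sdist j i)%:R) * `|u|.
Proof.
move=> x0 T0 th0 hc hLam; have [_ _ _ _ Phidiff] := flow.
apply: norm_diff_le; first exact: Phidiff.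
have updx : upd x i (x i) = x by apply/funext => k; rewrite /upd; case: eqP => [->|].
have [L [L0 hL]] := flow_lipschitz i x0 T0.
near=> a.
have small : L * `|a - x i| <= 1.
  rewrite mulrC -ler_pdivlMr // mul1r; near: a.
  apply/nbhs_ballP; exists L^-1; first by rewrite /= invr_gt0.
  move=> a; rewrite ball_prod_normE /ball_ /= distrC => /ltW.
  by [].
have hLa : forall s, 0 <= s <= T -> forall k,
    `|Phi s (upd x i a) k - Phi s x k| <= L * `|a - x i| by near: a.
rewrite updx [leRHS]mulrC.
apply: (@flow_perturbation x i a T (L * `|a - x i|) Lam theta c) => //.
- move=> s sT k; apply: le_trans (hc s sT k).
  rewrite /coupling lerD2r lerD2l; apply: ler_wpM2l => //; rewrite lerD2r lerD2l.
  rewrite -[leLHS]real_normK ?num_real //; apply: lerXn2r; rewrite ?nnegrE ?addr_ge0 //.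
  have := le_trans (hLa s sT k) small; rewrite prod_normE ge_max => /andP[/= h _].
  by apply: le_trans (lerD (lexx _) h); rewrite -[X in `|X| <= _](subrK (Phi s x k).1) addrC ler_normD.
- move=> s sT k; apply: le_trans (hLa s sT k) _.
  rewrite ler_peMr ?mulr_ge0 ?(ltW L0)//.
  by rewrite (le_trans _ (expR_ge1Dx _)) // lerDl.
- by rewrite (ltW T0) lexx.
Unshelve. all: by end_near. Qed.

End Perturbation.

(** * The deterministic limit *)

Lemma powR_unbounded (R : realType) (be N : R) : 0 < be -> 0 <= N ->
  exists Y, 1 <= Y /\ forall y, Y <= y -> N <= y `^ be.
Proof.
move=> b0 N0; exists (Num.max 1 (N `^ be^-1)); split; first by rewrite le_max lexx.
move=> y; rewrite ge_max => /andP[y1 yN].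
have -> : N = (N `^ be^-1) `^ be by rewrite -powRrM mulVf ?gt_eqF // powRr1.
apply: ge0_ler_powR => //; first exact: ltW.
  by rewrite nnegrE powR_ge0.
by rewrite nnegrE (le_trans ler01).
Qed.

(** With y = log t and z = m/t, for large t the weight is at most 2y + z. Comparing squares, D^2 (2y
    + z) <= (y^al + z)^2 follows from 2 D^2 <= y^(2 al - 1), which is where al > 1/2 enters, and D^2
    <= y^al. The term m/t is the slack offered by [perturbation_growth]. *)
Lemma sqrt_log_le (R : realType) (al D r : R) : 1 / 2 < al -> 0 <= D -> 0 <= r ->
  \forall t \near +oo, forall m,
    D * Num.sqrt (logw (t + r) m) <= ln t `^ al + m%:R / t.
Proof.
move=> al12 D0 r0.
have al0 : 0 < al by apply: lt_trans al12; rewrite divr_gt0.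
have b0 : 0 < 2 * al - 1 by move: al12; lra.
have [Y1 [Y11 hY1]] := @powR_unbounded R (2 * al - 1) (2 * D ^+ 2) b0
  (mulr_ge0 (ler0n R 2) (sqr_ge0 D)).
have [Y2 [Y21 hY2]] := @powR_unbounded R al (D ^+ 2) al0 (sqr_ge0 D).
have e2 := @expR1_ge2 R.
near=> t => m.
have t1 : expR 1 + r + 1 <= t by near: t; apply: nbhs_pinfty_ge; exact: num_real.
have t2 : expR (Num.max Y1 Y2) <= t by near: t; apply: nbhs_pinfty_ge; exact: num_real.
have t0 : 0 < t by lra.
set y := ln t.
have hy : Num.max Y1 Y2 <= y.
  by rewrite /y -[X in X <= _]expRK; rewrite ler_ln ?posrE ?expR_gt0.
have [hy1 hy2] : Y1 <= y /\ Y2 <= y by move: hy; rewrite ge_max => /andP[].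
have y1 : 1 <= y by apply: le_trans hy1.
set z := m%:R / t; have z0 : 0 <= z by rewrite divr_ge0 // ltW.
set P := y `^ al; have P0 : 0 <= P by exact: powR_ge0.
have mz : m%:R = z * t by rewrite /z mulfVK // gt_eqF.
have hw : logw (t + r) m <= 2 * y + z.
  rewrite -[leRHS]expRK /logw ler_ln ?posrE ?expR_gt0 //; last by have := ler0n R m; lra.
  rewrite expRD mulr_natl mulr2n expRD /y lnK ?posrE // mz.
  have h := expR_ge1Dx z.
  have : t * t * (1 + z) <= t * t * expR z by apply: ler_wpM2l => //; rewrite mulr_ge0 // ltW.
  have : t * (expR 1 + r + 1) <= t * t by apply: ler_wpM2l => //; exact: ltW.
  have : (expR 1 + r) * 1 <= (expR 1 + r) * t by apply: ler_wpM2l; lra.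
  have : z * t * 1 <= z * t * t by apply: ler_wpM2l; [rewrite mulr_ge0 // ltW|lra].
  by set e1 := expR 1; set ez := expR z; lra.
have hP2 : 2 * D ^+ 2 * y <= P ^+ 2.
  have -> : P ^+ 2 = y `^ (2 * al - 1) * y.
    rewrite /P -powR_mulrn ?powR_ge0 // -powRrM.
    have -> : al * 2%:R = (2 * al - 1) + 1 by ring.
    rewrite powRD ?powRr1 //; first by lra.
    by apply/implyP => _; rewrite gt_eqF //; lra.
  by apply: ler_wpM2r; [lra|exact: hY1].
have hP1 := hY2 _ hy2; rewrite -/P in hP1.
rewrite -(ler_pXn2r (n := 2)) // ?nnegrE ?mulr_ge0 ?sqrtr_ge0 ?addr_ge0 //.
rewrite exprMn sqr_sqrtr; last first.
  by apply: le_trans ler01 _; apply: logw_ge1; rewrite addr_ge0 // ltW.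
apply: le_trans (ler_wpM2l (sqr_ge0 D) hw) _.
have := ler_wpM2r z0 hP1; have := mulr_ge0 P0 z0; have := sqr_ge0 z.
by move: hP2; rewrite sqrrD; set D2 := D ^+ 2; lra.
Unshelve. all: by end_near. Qed.

Lemma derive1_slice (R : realType) (G : R * R -> R) (v : R * R) : differentiable G v ->
  derive1 (fun s => G (s, v.2)) v.1 = 'd G v (1, 0) /\
  derive1 (fun s => G (v.1, s)) v.2 = 'd G v (0, 1).
Proof.
case: v => q p dG /=; split.
- have di : is_diff q (fun s : R => (s, p)) (fun s : R => (s, 0 : R)).
    exact: (is_diff_pair (is_diff_id q) (is_diff_cst p q)).
  have d1 : differentiable (fun s : R => (s, p)) q by [].
  rewrite derive1E' ; last exact: (@differentiable_comp _ _ _ _ (fun s : R => (s, p)) G).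
  rewrite (@diff_comp _ _ _ _ (fun s : R => (s, p)) G q d1 dG) /=.
  by rewrite (@diff_val _ _ _ _ _ _ _ di).
- have di : is_diff p (fun s : R => (q, s)) (fun s : R => (0 : R, s)).
    exact: (is_diff_pair (is_diff_cst q p) (is_diff_id p)).
  have d1 : differentiable (fun s : R => (q, s)) p by [].
  rewrite derive1E' ; last exact: (@differentiable_comp _ _ _ _ (fun s : R => (q, s)) G).
  rewrite (@diff_comp _ _ _ _ (fun s : R => (q, s)) G p d1 dG) /=.
  by rewrite (@diff_val _ _ _ _ _ _ _ di).
Qed.

Lemma pbracket_le (R : realType) d (x : config R d) (i : site d) (f g : R * R -> R)
    (H : config R d -> R * R) (Mf Mg E : R) :
  (forall v, differentiable f v) -> (forall v, differentiable g v) ->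
  (forall v u, `|'d f v u| <= Mf * `|u|) -> (forall v u, `|'d g v u| <= Mg * `|u|) ->
  differentiable (fun a => H (upd x i a)) (x i) ->
  (forall u, `|'d (fun a => H (upd x i a)) (x i) u| <= E * `|u|) ->
  `|pbracket [:: i] (fun y => f (y i)) (fun y => g (H y)) x| <= 2 * Mf * Mg * E.
Proof.
move=> df dg hf hg dH hH.
have updi a : upd x i a i = a by rewrite /upd eqxx.
rewrite /pbracket big_seq1 /dq /dp.
have -> : (fun s : R => f (upd x i (s, (x i).2) i)) = fun s => f (s, (x i).2).
  by apply/funext => s; rewrite updi.
have -> : (fun s : R => f (upd x i ((x i).1, s) i)) = fun s => f ((x i).1, s).
  by apply/funext => s; rewrite updi.
have [-> ->] := derive1_slice (df (x i)).
pose F a := H (upd x i a).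
have dgF : differentiable (g \o F) (x i) by apply: differentiable_comp.
have [-> ->] := @derive1_slice R (g \o F) (x i) dgF.
have n1 : `|(1 : R, 0 : R)| = 1.
  by rewrite prod_normE /= normr1 normr0; apply/max_idPl.
have hgF u : `|'d (g \o F) (x i) u| <= Mg * E * `|u|.
  rewrite diff_comp //=; apply: le_trans (hg _ _) _; rewrite -mulrA.
  apply: ler_wpM2l (hH u).
  by have := hg (0, 0) (1, 0); rewrite n1 mulr1; apply: le_trans.
have n2 : `|(0 : R, 1 : R)| = 1.
  by rewrite prod_normE /= normr1 normr0; apply/max_idPr.
have := hf (x i) (1, 0); have := hf (x i) (0, 1).
have := hgF (1, 0); have := hgF (0, 1); rewrite n1 n2 !mulr1 => h1 h2 h3 h4.
apply: le_trans (ler_normB _ _) _; rewrite !normrM.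
have -> : 2 * Mf * Mg * E = Mf * (Mg * E) + Mf * (Mg * E) by ring.
by apply: lerD; apply: ler_pM.
Qed.

(** Keeps the set of admissible sites nonempty; otherwise the supremum would be minus infinity and
    could not be bounded below. *)
Lemma far_site d (i : site d) n : (0 < d)%N -> exists j : site d, (n <= sdist i j)%N.
Proof.
case: d i => // d i _; exists [ffun l => if l == ord0 then i l - n%:Z else i l].
by rewrite /sdist (bigD1 ord0) //= ffunE eqxx opprB addrCA subrr addr0 absz_nat leq_addr.
Qed.

Section Deterministic.
Context (R : realType) (d : nat) (K : R) (U : {poly R}).
Hypotheses (d0 : (0 < d)%N) (K0 : 0 < K) (U0 : forall r : R, 0 <= U.[r]).
Context (CU CL : R).
Hypotheses (CU1 : 1 <= CU) (hCU : forall q, 1 + q ^+ 4 <= CU * (U.[q] + 1)).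
Hypotheses (CL0 : 0 <= CL) (hCL : forall a b,
  `|U^`().[a] - U^`().[b]| <= CL * (1 + a ^+ 2 + b ^+ 2) * `|a - b|).
Context (Phi : R -> config R d -> config R d).
Hypothesis flow : is_flow K U Phi.

(** The estimate restarts at the last integer before [s], so it runs for at most one unit of time
    and costs a single factor [expR growth], however large [t] is. *)
Lemma energy_all_times x A : X0 K U x ->
  (forall n k, energy U (Phi n%:R x) k <= A * logw n%:R (sdist k (origin d))) ->
  forall t s, 0 <= s <= t -> forall k,
    energy U (Phi s x) k <= A * expR (growth d K CU) * logw t (sdist k (origin d)).
Proof.
move=> x0 hA t s /andP[s0 st] k; set g := growth d K CU.
have g0 : 0 <= g by apply: growth_ge0.
have L1 r j : 0 <= r -> 1 <= logw (r : R) (sdist j (origin d)) by move=> r0; apply: logw_ge1.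
have A0 : 0 <= A.
  rewrite -(pmulr_lge0 _ (lt_le_trans ltr01 (L1 0%:R k (ler0n R 0)))).
  by apply: le_trans (hA 0%N k); rewrite (le_trans ler01) // energy_ge1.
pose n := Num.truncn s.
have /andP[ns sn] : (n%:R <= s) && (s < n.+1%:R) by apply: truncn_itv.
have n0 := ler0n R n.
have [N hN] := energy_locally_bounded d0 K0 U0 CU1 hCU flow (n%:R + 1) x0.
have N0 : 0 <= N.
  rewrite -(pmulr_lge0 _ (lt_le_trans ltr01 (L1 0 k (lexx _)))).
  apply: le_trans (hN 0 _ k); first by rewrite (le_trans ler01) // energy_ge1.
  by rewrite lexx addr_ge0.
have sn1 : s - n%:R <= 1 by move: sn; rewrite -natr1; lra.
have := @energy_gronwall R d K U K0 U0 CU CU1 hCU Phi flow x n%:R 1 1 n%:R A N x0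
    (normr1 _) n0 _ (hA n) (s - n%:R) _ k.
have es : n%:R + 1 * (s - n%:R) = s by rewrite mul1r addrC subrK.
rewrite es => H.
apply: le_trans (H _ _) _.
- move=> r /andP[r0 r1] j; rewrite mul1r; apply: le_trans (hN _ _ j) _; first by apply/andP; split; lra.
  by apply: ler_wpM2l => //; apply: logw_mono.
- by rewrite subr_ge0 ns sn1.
rewrite -mulrA -[leRHS]mulrA; apply: ler_wpM2l => //; rewrite mulrC.
apply: ler_pM; rewrite ?expR_ge0 ?(le_trans ler01) ?L1 //.
  by rewrite ler_expR -[leRHS]mul1r; apply: ler_wpM2r.
by apply: logw_mono => //; apply: le_trans st.
Qed.

Lemma deterministic_limit (f g : R * R -> R) x A (i : site d) (al b : R) :
  bounded_C1 f -> bounded_C1 g -> 1 / 2 < al -> 0 < b -> X0 K U x ->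
  (forall n k, energy U (Phi n%:R x) k <= A * logw n%:R (sdist k (origin d))) ->
  (ereal_sup [set r : \bar R | exists j : site d,
                   t * (ln t) `^ al < (sdist i j)%:R /\
                   r = (expR (b * t) *
                        pbracket [:: i] (fun y : config R d => f (y i))
                                 (fun y : config R d => g (Phi t y j)) x)%:E])
       @[t --> +oo] --> (0 : \bar R).
Proof.
move=> [df _ [Mf hf]] [dg _ [Mg hg]] al12 b0 x0 hA.
have al0 : 0 < al by apply: lt_trans al12; rewrite divr_gt0.
pose A' := A * expR (growth d K CU).
have hE := energy_all_times x0 hA; rewrite -/A' in hE.
have A'0 : 0 <= A'.
  have l1 : 1 <= logw (0 : R) (sdist i (origin d)) by apply: logw_ge1.
  rewrite -(pmulr_lge0 _ (lt_le_trans ltr01 l1)).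
  by apply: le_trans (hE 0 0 _ i); rewrite ?lexx // (le_trans ler01) // energy_ge1.
clearbody A'.
have CU0 : 0 <= CU by apply: le_trans ler01 CU1.
pose Q := 1 + 3 * CL + (2 * d + 1)%:R * K.
have Q0 : 0 <= Q by rewrite /Q addr_ge0 ?mulr_ge0 ?(ltW K0) // addr_ge0 // mulr_ge0.
(* For m = |i - j| > t Lam and Lam >= 1, one has b t <= b m and t Lam < m, so b t + Lam t - (b + 2)
   m < -m < -t. *)
pose th := b + 2.
pose D := 2 * (2 * d + 1)%:R * expR (th + 2) * (Q * Num.sqrt (2 * (CU * A'))).
have D0 : 0 <= D by rewrite /D !mulr_ge0 ?expR_ge0 ?sqrtr_ge0.
pose r : R := (sdist i (origin d))%:R.
have r0 : 0 <= r by exact: ler0n.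
have hD := sqrt_log_le al12 D0 r0.
pose Cst := 2 * Mf * Mg.
have Cst0 : 0 <= Cst.
  have n1 : `|(1 : R, 0 : R)| = 1.
    by rewrite prod_normE /= normr1 normr0; apply/max_idPl.
  have := hf (0, 0) (1, 0); have := hg (0, 0) (1, 0); rewrite n1 !mulr1 => h1 h2.
  by rewrite /Cst !mulr_ge0 // ?(le_trans _ h1) ?(le_trans _ h2).
have lim0 : (fun t : R => (Cst * expR (- t))%:E) @ +oo --> (0 : \bar R).
  apply: cvg_EFin; first by apply: nearW.
  rewrite -[X in _ --> X](mulr0 Cst); apply: cvgM; first exact: cvg_cst.
  exact: cvgr_expR.
have lim0' : (fun t : R => (- (Cst * expR (- t)))%:E) @ +oo --> (0 : \bar R).
  by rewrite -oppe0; under eq_fun do rewrite EFinN; apply: cvgeN.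
apply: squeeze_cvge lim0' lim0.
near=> t.
have hDt : forall m, D * Num.sqrt (logw (t + r) m) <= ln t `^ al + m%:R / t by near: t.
have te : expR 1 <= t by near: t; apply: nbhs_pinfty_ge; exact: num_real.
have t0 : 0 < t by apply: lt_le_trans te; exact: expR_gt0.
have lt1 : 1 <= ln t.
  by rewrite -[X in X <= _](expRK 1) ler_ln ?posrE ?expR_gt0.
set Lam := ln t `^ al.
have Lam1 : 1 <= Lam by rewrite /Lam -[leLHS](powRr0 (ln t)) ler_powR // ltW.
(* The square root comes from (1 + q^2)^2 <= 2 (1 + q^4) and the quartic energy bound; the 3 in [Q]
   comes from 1 + (|q| + 1)^2 + q^2 <= 3 (1 + q^2). *)
pose c k := Q * Num.sqrt (2 * (CU * A') * logw t (sdist k (origin d))).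
have bound (j : site d) : t * Lam < (sdist i j)%:R ->
    `|expR (b * t) * pbracket [:: i] (fun y => f (y i)) (fun y => g (Phi t y j)) x|
    <= Cst * expR (- t).
  move=> hj.
  have hd := @flow_diff_le R d K U d0 K0 U0 CU CL CU1 hCU CL0 hCL Phi flow x i t Lam th c j.
  have := @pbracket_le R d x i f g (fun y => Phi t y j) Mf Mg
    (expR (Lam * t - th * (sdist j i)%:R)) df dg hf hg _ _.
  have [_ _ _ _ Phidiff] := flow.
  move=> /(_ (Phidiff x x0 t i j)) hp.
  rewrite normrM (ger0_norm (expR_ge0 _)).
  apply: le_trans (ler_wpM2l (expR_ge0 _) (hp _)) _.
    move=> u; apply: hd => //; first by rewrite /th; lra.
    - move=> s sT k; rewrite /coupling /c.
      have w1 : 1 <= logw t (sdist k (origin d)) by apply: logw_ge1; exact: ltW.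
      have hq := le_trans (energy_quartic CU1 hCU (Phi s x) k) (ler_wpM2l CU0 (hE t s sT k)).
      set q := (Phi s x k).1 in hq *; set w := logw _ _ in hq w1 *.
      apply: (@le_trans _ _ (Q * (1 + q ^+ 2))).
        have n2 : `|q| ^+ 2 = q ^+ 2 by rewrite real_normK // num_real.
        have h1 : 1 + (`|q| + 1) ^+ 2 + q ^+ 2 <= 3 * (1 + q ^+ 2).
          by have := sqr_ge0 (`|q| - 1); rewrite !sqrrD sqrrN n2; lra.
        have := ler_wpM2l CL0 h1.
        have : ((2 * d + 1)%:R * K) * 1 <= ((2 * d + 1)%:R * K) * (1 + q ^+ 2).
          by apply: ler_wpM2l; [rewrite mulr_ge0 // ltW|rewrite lerDl sqr_ge0].
        have := sqr_ge0 q; rewrite /Q.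
        by set Z := (2 * d + 1)%:R * K; set X := (`|q| + 1) ^+ 2; set Y := q ^+ 2; lra.
      apply: ler_wpM2l => //.
      have q0 : 0 <= 1 + q ^+ 2 by rewrite addr_ge0 ?sqr_ge0.
      rewrite -[leLHS]ger0_norm // -sqrtr_sqr ler_wsqrtr //.
      by have := sqr_ge0 (q ^+ 2 - 1); lra.
    - move=> k; apply: le_trans (_ : D * Num.sqrt (logw (t + r) (sdist k i)) <= _); last first.
        exact: hDt.
      have CA0 : 0 <= 2 * (CU * A') by rewrite !mulr_ge0.
      rewrite /D /c (sqrtrM _ CA0) (mulrA Q) mulrA; apply: ler_wpM2l => //.
      by apply: ler_wsqrtr; apply: logw_recenter; exact: ltW.
  rewrite mulrCA; apply: ler_wpM2l => //; rewrite -expRD ler_expR (sdistC j i).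
  have : t * 1 <= t * Lam by apply: ler_wpM2l => //; exact: ltW.
  have : b * t <= b * (sdist i j)%:R by apply: ler_wpM2l; [exact: ltW|nra].
  by move: hj; rewrite /th; set m := (sdist i j)%:R; lra.
have [|j0 hj0] := @far_site d i (Num.truncn (t * Lam)).+1; first exact: d0.
have hj0' : t * Lam < (sdist i j0)%:R.
  have /andP[_ h] : ((Num.truncn (t * Lam))%:R <= t * Lam) && (t * Lam < (Num.truncn (t * Lam)).+1%:R).
    by apply: truncn_itv; rewrite mulr_ge0 ?(ltW t0) // (le_trans ler01).
  by apply: lt_le_trans h _; rewrite ler_nat.
apply/andP; split.
  apply: le_trans (ereal_sup_ubound _); last by exists j0; split; [exact: hj0'|].
  by rewrite lee_fin; have := bound j0 hj0'; rewrite ler_norml => /andP[].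
apply: ge_ereal_sup => _ [j [hj ->]]; rewrite lee_fin.
by have := bound j hj; rewrite ler_norml => /andP[].
Unshelve. all: by end_near. Qed.

End Deterministic.

(** * Typical configurations *)

Section ProbabilityTools.
Import HBNNSimple.
Context (R : realType) (dT : measure_display) (T : measurableType dT).
Context (om : probability T R).

(** At level A the failures have total measure at most 2^-A after summing over r, and a point
    failing at every level lies in a null intersection. Measurable covers of the failures suffice,
    so [P] may involve the flow. *)
Lemma ae_exists_forall (P : nat -> nat -> T -> Prop) :
  (forall A r, exists B, [/\ measurable B, (forall x, ~ P A r x -> B x) &
     (om B <= (2^-1 ^+ A / (2 ^ r.+1)%:R)%:E)%E]) ->
  {ae om, forall x, exists A, forall r, P A r x}.
Proof.
move=> h.
have /choice[B hB] : forall Ar : nat * nat, exists B, [/\ measurable B,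
    (forall x, ~ P Ar.1 Ar.2 x -> B x) &
     (om B <= (2^-1 ^+ Ar.1 / (2 ^ Ar.2.+1)%:R)%:E)%E].
  by case=> A r; exact: h.
pose V A := \bigcup_r B (A, r).
have mV A : measurable (V A).
  by apply: bigcupT_measurable => r; have [] := hB (A, r).
have oV A : (om (V A) <= (2^-1 ^+ A)%:E)%E.
  apply: (@le_trans _ _ (\sum_(r <oo) om (B (A, r)))%E).
    by apply: measure_sigma_subadditive => // r; have [] := hB (A, r).
  have h0 : 0 <= 2^-1 ^+ A :> R by rewrite exprn_ge0 // invr_ge0.
  have := @epsilon_trick R (fun=> 0%E) (2^-1 ^+ A) xpredT (fun=> lexx _) h0.
  rewrite [in X in (_ <= X + _)%E]eseries0 // add0e; apply: le_trans.
  apply: lee_nneseries => // r _; rewrite add0e; by have [] := hB (A, r).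
exists (\bigcap_A V A); split.
- exact: bigcapT_measurable.
- apply/eqP; rewrite eq_le measure_ge0 andbT.
  apply/lee_addgt0Pr => e e0; rewrite add0e.
  have /cvgrPdist_lt /(_ e e0) [N _ hN] : (fun n => 2^-1 ^+ n : R) @ \oo --> (0 : R).
    by apply: cvg_expr; rewrite ger0_norm // invf_lt1 // ltr1n.
  apply: (@le_trans _ _ (om (V N))).
    by apply: le_measure; rewrite ?inE //; [exact: bigcapT_measurable|exact: bigcap_inf].
  apply: le_trans (oV N) _; rewrite lee_fin.
  have := hN N (leqnn N); rewrite /= sub0r normrN ger0_norm ?exprn_ge0 ?invr_ge0 //.
  exact: ltW.
- move=> x /= nx A _; apply: contrapT => nV; apply: nx; exists A => r.
  by apply: contrapT => nP; apply: nV; exists r => //; have [_ + _] := hB (A, r); apply.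
Qed.

Lemma finite_union_bound (J : eqType) (s : seq J) (P : J -> T -> Prop) (e : R) :
  (forall j, j \in s -> exists B, [/\ measurable B, (forall x, ~ P j x -> B x) & (om B <= e%:E)%E]) ->
  exists B, [/\ measurable B, (forall x, ~ (forall j, j \in s -> P j x) -> B x) &
     (om B <= ((size s)%:R * e)%:E)%E].
Proof.
elim: s => [|j s IH] h.
  exists set0; split => //; first by move=> x []; move=> j; rewrite in_nil.
  by rewrite measure0 mul0r.
have [|B1 [m1 h1 o1]] := IH.
  by move=> l ls; apply: h; rewrite inE ls orbT.
have [|B2 [m2 h2 o2]] := h j; first by rewrite inE eqxx.
exists (B2 `|` B1); split; first exact: measurableU.
- move=> x nx; have [Pj|nPj] := pselect (P j x); last by left; exact: h2.
  right; apply: h1 => hs; apply: nx => l; rewrite inE => /predU1P[->//|]; exact: hs.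
- apply: le_trans (measureU2 _ m2 m1) _.
  by rewrite /= -natr1 mulrDl mul1r addrC EFinD; apply: leeD.
Qed.

Lemma exponential_markov (W : T -> R) (lam c a : R) :
  measurable_fun setT W -> 0 < lam ->
  (\int[om]_x (expR (lam * W x))%:E <= (expR c)%:E)%E ->
  exists B, [/\ measurable B, (forall x, ~ W x <= a -> B x) &
    (om B <= (expR (c - lam * a))%:E)%E].
Proof.
move=> mW l0 hW; pose B := W @^-1` `]a, +oo[.
have mB : measurable B.
  by rewrite /B -[X in measurable X]setTI; apply: mW => //; exact: measurable_itv.
exists B; split => //.
  by move=> x /negP; rewrite -ltNge /B /= in_itv /= andbT.
have mE : measurable_fun setT (EFin \o (fun x => expR (lam * W x))).
  by apply/measurable_EFinP; apply: measurableT_comp => //; exact: measurable_funM.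
rewrite expRD expRN EFinM lee_pdivlMr ?expR_gt0 // muleC.
apply: le_trans hW.
apply: le_trans (_ : (\int[om]_(x in B) (expR (lam * W x))%:E <= _)%E).
  rewrite -integral_cst //; apply: ge0_le_integral => //.
  - by move=> x _; rewrite lee_fin expR_ge0.
  - exact: measurable_funTS.
  - move=> x; rewrite /B /= in_itv /= andbT => h; rewrite lee_fin ler_expR.
    by rewrite ler_wpM2l // ltW.
by apply: ge0_subset_integral => // x _; rewrite lee_fin expR_ge0.
Qed.

(* The integral of a possibly non-measurable function is a lower integral, so
   applying the invariance hypothesis to [F] close to [1] bounds the outer measure of
   the set where [F \o S] is not close to [1]. *)
Lemma invariant_outer_bound (F : T -> R) (S : T -> T) (de : R) : 0 < de ->
  (forall x, 0 <= F x <= 1) ->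
  (\int[om]_x (F (S x))%:E = \int[om]_x (F x)%:E)%E ->
  ((1 - de)%:E <= \int[om]_x (F x)%:E)%E ->
  exists B, [/\ measurable B, (forall x, F (S x) <= 1 / 2 -> B x) & (om B <= (4 * de)%:E)%E].
Proof.
move=> de0 F01 inv hF.
have : ((1 - 2 * de)%:E < \int[om]_x (F (S x))%:E)%E.
  by rewrite inv; apply: lt_le_trans hF; rewrite lte_fin; lra.
rewrite ge0_integralTE; last by move=> x; rewrite lee_fin; case/andP: (F01 (S x)).
move=> /ereal_sup_gt[_ [h /= hh <-]]; rewrite -integralT_nnsfun => hde.
have h1 x : h x <= 1.
  by have := hh x; rewrite lee_fin => /le_trans; apply; case/andP: (F01 (S x)).
pose B := h @^-1` `]-oo, (1 / 2 : R)].
have mB : measurable B by rewrite /B -[X in measurable X]setTI; exact: measurable_funP.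
exists B; split => //.
  by move=> x hx; rewrite /B /= in_itv /=; apply: le_trans hx; have := hh x; rewrite lee_fin.
(* The simple function [h] lies below [F \o S] and has integral above 1 - 2 de. As h + 1/2 on [B]
   and h elsewhere are at most 1, half the measure of [B] is less than 2 de. *)
have key : (\int[om]_x (h x)%:E + (1 / 2)%:E * om B <= 1)%E.
  have -> : om B = (\int[om]_x (\1_B x)%:E)%E by rewrite integral_indic // setIT.
  have mh : measurable_fun setT (EFin \o h) by apply/measurable_EFinP; exact: measurable_funP.
  have mi : measurable_fun setT (EFin \o (\1_B : T -> R)).
    by apply/measurable_EFinP; exact: measurable_indic.
  have mi2 : measurable_fun setT (fun x => (1 / 2)%:E * (\1_B x : R)%:E)%E.
    exact: measurable_funeM.
  rewrite -ge0_integralZl //.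
  rewrite -ge0_integralD //; last by move=> x _; rewrite lee_fin; exact: fun_ge0.
  rewrite -[leRHS](@probability_setT _ _ _ om) -[leRHS]mul1e -(integral_cst om measurableT 1%E).
  apply: ge0_le_integral => //.
  - by move=> x _; rewrite -EFinM -EFinD lee_fin addr_ge0 ?mulr_ge0 //; exact: fun_ge0.
  - exact: emeasurable_funD.
  - move=> x _; rewrite -EFinM -EFinD lee_fin indicE; have [xB|xB] := boolP (x \in B).
      by move: xB; rewrite inE /B /= in_itv /= (_ : true%:R = 1) //; lra.
    by rewrite (_ : false%:R = 0) // mulr0 addr0.
move: hde key; rewrite -[om B]fineK ?fin_num_measure //.
case: (\int[om]_x (h x)%:E)%E => [r| |] //.
rewrite lte_fin -EFinM -EFinD !lee_fin; lra.
Qed.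

End ProbabilityTools.

(** * Measurability and local observables *)

Lemma continuous_measurable (R : realType) d (h : {ptws site d -> (R * R)%type} -> R) :
  continuous h -> measurable_fun setT (h : Xmeas R d -> R).
Proof.
move=> /continuousP ch; apply: (measurability _ (RGenOpens.measurableE R)).
move=> _ [_ [a [b ->] <-]]; rewrite setTI; apply: sub_sigma_algebra.
by apply: ch; exact: interval_open.
Qed.

Lemma continuous_site_fun (R : realType) d (k : site d) (h : R * R -> R) : continuous h ->
  continuous (fun x : {ptws site d -> (R * R)%type} => h (x k)).
Proof.
move=> ch x; apply: (@cvg_comp _ _ _ (fun x : {ptws site d -> (R * R)%type} => x k) h).
  exact: (@proj_continuous (site d) (fun=> (R * R)%type) k x).
exact: ch.
Qed.

Lemma continuous_sum (R : realType) (X : topologicalType) (I : Type) (s : seq I) (P : pred I)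
    (F : I -> X -> R) :
  (forall i, continuous (F i)) -> continuous (fun x => \sum_(i <- s | P i) F i x).
Proof.
move=> cF; elim: s => [|i s IH] x.
  have -> : (fun x => \sum_(i <- [::] | P i) F i x) = cst 0.
    by apply/funext => y; rewrite big_nil.
  exact: cvg_cst.
have -> : (fun x => \sum_(j <- i :: s | P j) F j x) =
    (if P i then F i else cst 0) + (fun x => \sum_(j <- s | P j) F j x).
  by apply/funext => y; rewrite big_cons fctE; case: ifP => // _; rewrite add0r.
apply: cvgD; last exact: IH.
by case: ifP => _; [exact: cF|exact: cvg_cst].
Qed.

Lemma continuous_sqr_sub (R : realType) (X : topologicalType) (c : R) (f g : X -> R) :
  continuous f -> continuous g -> continuous (fun x => c * (f x - g x) ^+ 2).
Proof.
move=> cf cg x; apply: cvgM; first exact: cvg_cst.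
by apply: (cvgM (cvgB (cf x) (cg x)) (cvgB (cf x) (cg x))).
Qed.

Lemma continuous_add (R : realType) (X : topologicalType) (f g : X -> R) :
  continuous f -> continuous g -> continuous (fun x => f x + g x).
Proof. by move=> cf cg x; exact: cvgD (cf x) (cg x). Qed.

Lemma differentiable_fst (R : realType) (V W : normedModType R) (v : V * W) :
  differentiable (fun w : V * W => w.1) v.
Proof.
apply: (@linear_differentiable _ _ _ (fst : {linear (V * W)%type -> V}) v) => w.
exact: cvg_fst.
Qed.

Lemma differentiable_snd (R : realType) (V W : normedModType R) (v : V * W) :
  differentiable (fun w : V * W => w.2) v.
Proof.
apply: (@linear_differentiable _ _ _ (snd : {linear (V * W)%type -> W}) v) => w.
exact: cvg_snd.
Qed.

Section Observables.
Context (R : realType) (d : nat) (K : R) (U : {poly R}).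

Definition site_energy (v : R * R) : R := v.2 ^+ 2 / 2 + U.[v.1] + 1.

Lemma differentiable_site_energy v : differentiable site_energy v.
Proof.
apply: differentiableD; last exact: differentiable_cst.
apply: differentiableD.
  apply: differentiableM; last exact: differentiable_cst.
  rewrite (_ : (fun w : R * R => w.2 ^+ 2) = (fun w : R * R => w.2) * (fun w : R * R => w.2)); last first.
    by apply/funext => w; rewrite !fctE expr2.
  by apply: differentiableM; exact: differentiable_snd.
apply: (@differentiable_comp _ _ _ _ (fun w : R * R => w.1) (horner U)).
  exact: differentiable_fst.
by apply/derivable1_diffP; have [] := is_derive_poly U v.1.
Qed.

Lemma continuous_site_energy : continuous site_energy.
Proof. by move=> v; apply: differentiable_continuous; exact: differentiable_site_energy. Qed.

Lemma measurable_Wloc nu k : measurable_fun setT (Wloc K U nu k : Xmeas R d -> R).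
Proof.
apply: (@continuous_measurable R d (Wloc K U nu k)).
have cq (j : site d) : continuous (fun x : {ptws site d -> (R * R)%type} => (x j).1).
  by apply: (@continuous_site_fun R d j (fun v => v.1)) => v; exact: cvg_fst.
have h1 : continuous (fun x : {ptws site d -> (R * R)%type} =>
    \sum_(w : {ffun 'I_d -> 'I_(2 * k + 1)}) site_energy (x (cube_pt nu w))).
  apply: (@continuous_sum R {ptws site d -> (R * R)%type} _ _ _
      (fun w x => site_energy (x (cube_pt nu w)))) => w.
  exact: (@continuous_site_fun R d (cube_pt nu w) site_energy continuous_site_energy).
have h2 : continuous (fun x : {ptws site d -> (R * R)%type} =>
    \sum_(w : {ffun 'I_d -> 'I_(2 * k + 1)})
    \sum_(w' : {ffun 'I_d -> 'I_(2 * k + 1)} | sdist (cube_pt nu w') (cube_pt nu w) == 1%N)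
       K / 4 * ((x (cube_pt nu w)).1 - (x (cube_pt nu w')).1) ^+ 2).
  apply: (@continuous_sum R {ptws site d -> (R * R)%type} _ _ _ (fun w x =>
    \sum_(w' : {ffun 'I_d -> 'I_(2 * k + 1)} | sdist (cube_pt nu w') (cube_pt nu w) == 1%N)
       K / 4 * ((x (cube_pt nu w)).1 - (x (cube_pt nu w')).1) ^+ 2)) => w.
  apply: (@continuous_sum R {ptws site d -> (R * R)%type} _ _ _ (fun w' x =>
       K / 4 * ((x (cube_pt nu w)).1 - (x (cube_pt nu w')).1) ^+ 2)) => w'.
  exact: (@continuous_sqr_sub R {ptws site d -> (R * R)%type} (K / 4) _ _ (cq _) (cq _)).
exact: (@continuous_add R {ptws site d -> (R * R)%type} _ _ h1 h2).
Qed.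

Lemma diff_site_energy (v u : R * R) :
  `|'d site_energy v u| <= (`|U^`().[v.1]| + `|v.2|) * `|u|.
Proof.
have [e1 e2] := derive1_slice (differentiable_site_energy v).
have d1 : 'd site_energy v (1, 0) = U^`().[v.1].
  rewrite -e1 derive1E /site_energy /=.
  have h := is_deriveD (is_deriveD (is_derive_cst (v.2 ^+ 2 / 2 : R) v.1 (1 : R))
     (is_derive_poly U v.1)) (is_derive_cst (1 : R) v.1 (1 : R)).
  by rewrite (@derive_val _ _ _ _ _ _ _ h) add0r addr0.
have d2 : 'd site_energy v (0, 1) = v.2.
  rewrite -e2 derive1E /site_energy /=.
  have i2 := is_derive_id v.2 (1 : R).
  have h := is_deriveD (is_deriveD (is_deriveZ (2^-1 : R) (is_deriveM i2 i2))
     (is_derive_cst (U.[v.1] : R) v.2 (1 : R))) (is_derive_cst (1 : R) v.2 (1 : R)).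
  have -> : (fun s : R => s ^+ 2 / 2 + U.[v.1] + 1) =
     ((2^-1 \*: ((id : R -> R) * id)) + cst U.[v.1] + cst 1).
    by apply/funext => s; rewrite !fctE mulrC expr2.
  rewrite (@derive_val _ _ _ _ _ _ _ h) !addr0.
  have -> : 2^-1 *: (id v.2 *: (1 : R) + id v.2 *: (1 : R)) = 2^-1 * (v.2 * 1 + v.2 * 1) by [].
  by field.
have eu : u = u.1 *: (1, 0) + u.2 *: (0, 1).
  rewrite [LHS](_ : _ = (u.1 * 1 + u.2 * 0, u.1 * 0 + u.2 * 1)) //.
  by case: u => a b /=; rewrite !mulr1 !mulr0 addr0 add0r.
rewrite [in 'd _ _ _]eu linearD !linearZ /= d1 d2; apply: le_trans (ler_normD _ _) _.
have := normr_ge0 u; rewrite prod_normE => _.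
rewrite mulrDl; apply: lerD.
  by rewrite normrZ mulrC; apply: ler_wpM2l => //; rewrite le_max lexx.
by rewrite normrZ mulrC; apply: ler_wpM2l => //; rewrite le_max lexx orbT.
Qed.

(** A reversed logistic function with value 1/2 at z = a / lam. Its derivative decays exponentially
    in the energy, which compensates the unbounded gradient of the energy. *)
Definition cutoff (lam a z : R) : R := (1 + expR (lam * z - a))^-1.

Lemma is_derive_cutoff lam a z :
  is_derive z (1 : R) (cutoff lam a)
    (- (1 + expR (lam * z - a)) ^- 2 * (lam * expR (lam * z - a))).
Proof.
have ex y : expR (lam * y - a) = expR (- a) * expR (y * lam).
  by rewrite -expRD addrC (mulrC y).
have h1 : is_derive z (1 : R) (fun z => 1 + expR (lam * z - a)) (lam * expR (lam * z - a)).
  have h := @is_derive_cexp R (expR (- a)) lam z.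
  have h' := is_deriveD (is_derive_cst (1 : R) z (1 : R)) h.
  have -> : lam * expR (lam * z - a) = 0 + lam * (expR (- a) * expR (z * lam)).
    by rewrite add0r ex.
  have -> : (fun z => 1 + expR (lam * z - a)) = cst 1 + (fun s => expR (- a) * expR (s * lam)).
    by apply/funext => s; rewrite !fctE ex.
  exact: h'.
apply: is_deriveV h1.
by rewrite gt_eqF // addr_gt0 // expR_gt0.
Qed.

Lemma cutoff_ge0 lam a z : 0 <= cutoff lam a z <= 1.
Proof.
have := expR_ge0 (lam * z - a) => h; apply/andP; split.
  by rewrite invr_ge0 addr_ge0.
by rewrite invf_le1 ?lerDl // (lt_le_trans ltr01) // lerDl.
Qed.

Lemma cutoff_small lam z y : 0 < lam -> z <= y -> cutoff lam (lam * z) y <= 1 / 2.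
Proof.
move=> l0 zy; rewrite /cutoff div1r lef_pV2 ?posrE ?addr_gt0 ?expR_gt0 //.
rewrite -[leLHS]/(1 + 1) lerD2l -expR0 ler_expR subr_ge0.
by rewrite ler_wpM2l // ltW.
Qed.

(** Turns an exponential moment of the energy into a lower bound for the integral of the cutoff:
    with X the exponential, 1 - 1/(1 + X) <= X. *)
Lemma cutoff_lower lam a z : 1 <= cutoff lam a z + expR (- a) * expR (lam * z).
Proof.
have -> : expR (- a) * expR (lam * z) = expR (lam * z - a) by rewrite -expRD addrC.
rewrite /cutoff; have h := expR_gt0 (lam * z - a); set X := expR _ in h *.
have X1 : 0 < 1 + X by rewrite addr_gt0.
by rewrite -(ler_pM2r X1) mulrDl mulVf ?gt_eqF // mul1r; nra.
Qed.

Hypotheses (U0 : forall r : R, 0 <= U.[r]).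
Context (CU CL : R).
Hypotheses (CU1 : 1 <= CU) (hCU : forall q, 1 + q ^+ 4 <= CU * (U.[q] + 1)).
Hypotheses (CL0 : 0 <= CL) (hCL : forall a b,
  `|U^`().[a] - U^`().[b]| <= CL * (1 + a ^+ 2 + b ^+ 2) * `|a - b|).

Lemma site_energy_ge1 v : 1 <= site_energy v.
Proof. exact: (@energy_ge1 R d U U0 (fun=> v) (origin d)). Qed.

Lemma gradient_le_energy v :
  `|U^`().[v.1]| + `|v.2| <= (`|U^`().[0]| + CL * CU + 1) * site_energy v.
Proof.
have e1 := site_energy_ge1 v; set e := site_energy v in e1 *.
have e4 : 1 + v.1 ^+ 4 <= CU * e by exact: (@energy_quartic R d U CU CU1 hCU (fun=> v) (origin d)).
have e2 : v.2 ^+ 2 <= 2 * e by exact: (@energy_p2 R d U U0 (fun=> v) (origin d)).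
have h1 : `|v.2| <= e.
  have : `|v.2| <= (v.2 ^+ 2 + 1) / 2.
    by rewrite ler_norml; have := sqr_ge0 (v.2 - 1); have := sqr_ge0 (v.2 + 1); lra.
  have : v.2 ^+ 2 / 2 + 1 <= e by rewrite /e /site_energy; have := U0 v.1; lra.
  by lra.
have h2 : `|U^`().[v.1]| <= `|U^`().[0]| + CL * (CU * e).
  have h3 := hCL v.1 0; rewrite subr0 expr0n addr0 in h3.
  have h4 : (1 + v.1 ^+ 2) * `|v.1| <= CU * e.
    apply: le_trans e4.
    have n2 : `|v.1| ^+ 2 = v.1 ^+ 2 by rewrite real_normK // num_real.
    have : `|v.1| <= (1 + v.1 ^+ 2) / 2.
      by have := sqr_ge0 (`|v.1| - 1); rewrite sqrrB n2; lra.
    move=> h; apply: le_trans (ler_wpM2l _ h) _; first by rewrite addr_ge0 ?sqr_ge0.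
    by have := sqr_ge0 (v.1 ^+ 2 - 1); lra.
  have h5 := ler_wpM2l CL0 h4; rewrite mulrA in h5.
  rewrite -[X in `|X| <= _](subrK U^`().[0]); apply: le_trans (ler_normD _ _) _.
  by rewrite addrC lerD2l; apply: le_trans h3 _.
have h6 : `|U^`().[0]| * 1 <= `|U^`().[0]| * e by exact: ler_wpM2l.
by rewrite !mulrDl mul1r -mulrA; lra.
Qed.

(** By the chain rule the differential is at most |cutoff'(e)| times a multiple of e, since the
    gradient of the energy is linearly bounded by the energy; this product is bounded. *)
Lemma local_obs_cutoff lam a k : 0 < lam -> local_obs (fun x : config R d => cutoff lam a (energy U x k)).
Proof.
move=> l0; pose iota (w : 'rV[R]_1 * 'rV[R]_1) : R * R := (w.1 0 0, w.2 0 0).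
have entry (w : 'rV[R]_1) : `|w 0 0| <= `|w|.
  rewrite [leRHS]/Num.norm /= mx_normrE; apply/bigmax_geP; right => /=.
  by exists (0, 0).
have diota w : differentiable iota w.
  apply: differentiable_pair.
    apply: (@differentiable_comp _ _ _ _ (fun w : 'rV[R]_1 * 'rV[R]_1 => w.1) (fun N : 'rV[R]_1 => N 0 0)).
      exact: differentiable_fst.
    exact: differentiable_coord.
  apply: (@differentiable_comp _ _ _ _ (fun w : 'rV[R]_1 * 'rV[R]_1 => w.2) (fun N : 'rV[R]_1 => N 0 0)).
    exact: differentiable_snd.
  exact: differentiable_coord.
have niota w u : `|'d iota w u| <= 1 * `|u|.
  apply: norm_diff_le => //; apply: (@nearW _ _ _ (nbhs_filter w)) => z; rewrite mul1r.
  rewrite !prod_normE ge_max; apply/andP; split => /=.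
    by have := entry (z - w).1; rewrite !mxE le_max => ->.
  by have := entry (z - w).2; rewrite !mxE le_max => ->; rewrite orbT.
have dcut z : differentiable (cutoff lam a) z.
  by apply/derivable1_diffP; have [] := is_derive_cutoff lam a z.
have dse w : differentiable (site_energy \o iota) w.
  by apply: differentiable_comp => //; exact: differentiable_site_energy.
exists 0%N, (fun=> k), (cutoff lam a \o (site_energy \o iota)); split.
- by move=> x; rewrite /= /iota !mxE.
- by move=> v; exact: differentiable_comp.
- exists 1 => v /=; have /andP[h1 h2] := cutoff_ge0 lam a (site_energy (iota v)).
  by rewrite ger0_norm.
pose Cg := `|U^`().[0]| + CL * CU + 1.
have Cg0 : 0 <= Cg by rewrite /Cg !addr_ge0 // mulr_ge0 // (le_trans ler01).
exists (expR a * Cg) => w u.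
set e := site_energy (iota w).
have e1 : 1 <= e by exact: site_energy_ge1.
(* With X = exp(lam e - a), lam e <= exp(lam e) = X exp a, hence lam e X <= exp a X^2 <= exp a (1 +
   X)^2. *)
have hc : `|(cutoff lam a)^`()%classic e| * e <= expR a.
  rewrite derive1E (@derive_val _ _ _ _ _ _ _ (is_derive_cutoff lam a e)).
  have X0 := expR_gt0 (lam * e - a); have Xe : expR (lam * e) = expR (lam * e - a) * expR a.
    by rewrite -expRD subrK.
  have := expR_ge1Dx (lam * e); rewrite Xe; set X := expR _ in X0 *; move=> hX.
  have X1 : 0 < 1 + X by rewrite addr_gt0.
  have Y0 : 0 < (1 + X) ^- 2 by rewrite invr_gt0 exprn_gt0.
  have Z0 : 0 <= lam * X by rewrite mulr_ge0 // ltW.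
  rewrite normrM normrN (gtr0_norm Y0) (ger0_norm Z0).
  rewrite -mulrA ler_pdivrMl ?exprn_gt0 //.
  have h1 : lam * e * X <= X * expR a * X by apply: ler_wpM2r; lra.
  have h2 : 0 <= expR a * (1 + 2 * X) by rewrite mulr_ge0 ?expR_ge0 // addr_ge0 // mulr_ge0 // ltW.
  move: h1 h2; set E := expR a; nra.
have hse : `|'d (site_energy \o iota) w u| <= Cg * e * `|u|.
  rewrite diff_comp //=; last exact: differentiable_site_energy.
  apply: le_trans (diff_site_energy _ _) _; apply: ler_pM => //.
    exact: gradient_le_energy.
  by have := niota w u; rewrite mul1r.
rewrite diff_comp //= (diff1E (dcut _)) /= normrZ.
apply: le_trans (ler_wpM2r _ hse) _; first exact: normr_ge0.
have := ler_wpM2l (mulr_ge0 Cg0 (normr_ge0 u)) hc.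
by rewrite -/e; set c' := `|_^`()%classic e|; lra.
Qed.

End Observables.

(** * Almost sure bounds from exponential moments *)

Lemma in_cube d (k : site d) N : (sdist k (origin d) <= N)%N ->
  exists o : {ffun 'I_d -> 'I_(2 * N + 1)}, cube_pt (origin d) o = k.
Proof.
move=> kN.
have hl l : (`|k l|%N <= N)%N.
  apply: leq_trans kN; rewrite /sdist (bigD1 l) //= ffunE subr0.
  exact: leq_addr.
have hb l : (`|(k l + N%:Z)%R|%N < 2 * N + 1)%N by have := hl l; lia.
exists [ffun l => Ordinal (hb l)]; apply/ffunP => l; rewrite !ffunE /=.
by have := hl l; lia.
Qed.

Lemma expR_half_le2 (R : realType) : expR (1 / 2 : R) <= 2.
Proof.
have h := expR_ge1Dx (- (1 / 2) : R); rewrite expRN in h.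
have h0 := expR_gt0 (1 / 2 : R).
have : (1 - 1 / 2) * expR (1 / 2) <= (1 : R).
  by rewrite -ler_pdivlMr // [X in _ <= X]div1r.
lra.
Qed.

(** Groups times and sites into dyadic scales: scale r contains exponentially many pairs in r, which
    a threshold linear in r can beat, and r is comparable to the logarithmic weight. *)
Lemma dyadic_scale (R : realType) (m n : nat) : exists r : nat,
  [/\ (m <= 2 ^ r)%N, (n <= 2 ^ r)%N & (r.+1)%:R <= 4 * logw (n%:R : R) m].
Proof.
pose q := trunc_log 2 (m + n).+1.
have /andP[q1 q2] : (2 ^ q <= (m + n).+1 < 2 ^ q.+1)%N by exact: trunc_log_bounds.
exists q.+1; split.
- by apply: ltnW; apply: leq_ltn_trans q2; apply: leqW; exact: leq_addr.
- by apply: ltnW; apply: leq_ltn_trans q2; apply: leqW; exact: leq_addl.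
have L1 : 1 <= logw (n%:R : R) m by apply: logw_ge1.
have : q%:R / 2 <= logw (n%:R : R) m.
  rewrite -[leLHS]expRK /logw ler_ln ?posrE ?expR_gt0 //.
  have -> : q%:R / 2 = q%:R * (1 / 2) :> R by rewrite mul1r.
  rewrite expRM_natl; apply: le_trans (_ : (2 ^ q)%:R <= _).
    by rewrite natrX lerXn2r ?nnegrE ?expR_ge0 // expR_half_le2.
  have : ((2 ^ q)%:R : R) <= (m + n).+1%:R by rewrite ler_nat.
  have -> : (m + n).+1%:R = m%:R + n%:R + 1 :> R by rewrite -natr1 natrD.
  by have := @expR1_ge2 R; set e1 := expR 1; lra.
have -> : q.+2%:R = q%:R + 2 :> R by rewrite -addn2 natrD.
by lra.
Qed.

Lemma expRN_le_half_pow (R : realType) (n : nat) : expR (- n%:R) <= 2^-1 ^+ n :> R.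
Proof.
rewrite -mulN1r mulrC expRM_natl lerXn2r ?nnegrE ?expR_ge0 ?invr_ge0 //.
by rewrite expRN lef_pV2 ?posrE ?expR_gt0 // expR1_ge2.
Qed.

Section AlmostEverywhere.
Context (R : realType) (d : nat) (K : R) (U : {poly R}).
Context (om : probability (Xmeas R d) R) (C lam : R).
Hypotheses (C0 : 0 < C) (l0 : 0 < lam) (hW : forall (nu : site d) (k : nat),
       (\int[om]_x (expR (lam * Wloc K U nu k x))%:E
          <= (expR (C * ((2 * k + 1) ^ d)%:R))%:E)%E).
Hypotheses (d0 : (0 < d)%N) (K0 : 0 < K).

Lemma ae_X0 : {ae om, forall x : Xmeas R d, X0 K U x}.
Proof.
(* In units of the volume w of the cube: C is the cost of the moment, 3d that of the number of
   centres, and 1 leaves the summable decay. *)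
pose c2 := C + 3 * d%:R + 1.
pose z (A : nat) : R := (A%:R + c2) / lam.
(* A cube with parameter r is admissible in [Qfun] only for centres with log(e + |nu|) < r^d, so
   finitely many centres matter for each r. *)
pose N (r : nat) := Num.truncn (expR (r%:R ^+ d) : R).
have hP := @ae_exists_forall R _ (Xmeas R d) om (fun A r x =>
  forall nu, (sdist nu (origin d) <= N r)%N -> Wloc K U nu r x <= z A * ((2 * r + 1) ^ d)%:R).
apply: filterS (hP _) => [x [A hA]|A r].
  apply/X0P; exists (z A) => nu k hk.
  rewrite ler_pdivrMr ?ltr0n ?expn_gt0 ?addn1 // -addn1; apply: hA.
  have L1 : 1 <= logw (0 : R) (sdist nu (origin d)) by apply: logw_ge1.
  set L := logw _ _ in hk L1.
  have hL : L <= k%:R ^+ d.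
    have -> : L = (L `^ d%:R^-1) ^+ d.
      rewrite -powR_mulrn ?powR_ge0 // -powRrM mulVf ?pnatr_eq0 -?lt0n // powRr1 //.
      exact: le_trans ler01 L1.
    by rewrite lerXn2r ?nnegrE ?powR_ge0 // ltW.
  rewrite /N -(ler_nat R).
  have : (sdist nu (origin d))%:R <= expR (k%:R ^+ d) :> R.
    apply: le_trans (_ : expR L <= _); last by rewrite ler_expR.
    rewrite /L /logw lnK ?posrE; have := expR_gt0 (1 : R); have := ler0n R (sdist nu (origin d)); lra.
  by move=> h; rewrite ler_nat truncn_ge_nat ?expR_ge0.
have [|B [mB hB oB]] := @finite_union_bound R _ (Xmeas R d) om _
  (enum {ffun 'I_d -> 'I_(2 * N r + 1)})
  (fun w x => Wloc K U (cube_pt (origin d) w) r x <= z A * ((2 * r + 1) ^ d)%:R)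
  (expR (C * ((2 * r + 1) ^ d)%:R - lam * (z A * ((2 * r + 1) ^ d)%:R))).
  move=> w _; apply: exponential_markov => //; exact: measurable_Wloc.
exists B; split => //.
  move=> x nP; apply: hB => h; apply: nP => nu hnu.
  by have [w <-] := in_cube hnu; apply: h; rewrite mem_enum.
apply: le_trans oB _; rewrite lee_fin -cardE card_cube.
set w : R := ((2 * r + 1) ^ d)%:R.
have wr : r.+1%:R <= w.
  rewrite /w ler_nat; apply: (@leq_trans ((2 * r + 1) ^ 1)); first by rewrite expn1; lia.
  by apply: leq_pexp2l => //; lia.
have r1 : 1 <= r.+1%:R :> R by rewrite ler1n.
have rdw : r%:R ^+ d <= w.
  by rewrite /w natrX lerXn2r ?nnegrE // ler_nat; lia.
have hN : (2 * N r + 1)%:R <= expR (3 * w).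
  have h1 : (N r)%:R <= expR w.
    apply: le_trans (_ : expR (r%:R ^+ d) <= _); last by rewrite ler_expR.
    by rewrite truncn_le expR_ge0.
  have h2 : 3 <= expR (2 * w).
    by have := expR_ge1Dx (2 * w); lra.
  have h3 : 1 <= expR w by have := expR_ge1Dx w; lra.
  have -> : 3 * w = 2 * w + w by ring.
  rewrite expRD natrD natrM; have := ler_wpM2r (expR_ge0 w) h2; lra.
have hcard : ((2 * N r + 1) ^ d)%:R <= expR (d%:R * (3 * w)) :> R.
  by rewrite natrX expRM_natl lerXn2r ?nnegrE ?expR_ge0.
apply: le_trans (ler_wpM2r (expR_ge0 _) hcard) _.
have -> : 2^-1 ^+ A / (2 ^ r.+1)%:R = 2^-1 ^+ (A + r.+1) :> R.
  by rewrite exprD natrX (exprVn _ r.+1).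
apply: le_trans (expRN_le_half_pow R (A + r.+1)).
rewrite -expRD ler_expR /z.
have -> : lam * ((A%:R + c2) / lam * w) = (A%:R + c2) * w.
  by rewrite mulrA mulrCA mulfV ?mulr1 // gt_eqF.
have h1 : A%:R * 1 <= A%:R * w by apply: ler_wpM2l => //; lra.
by rewrite natrD /c2; move: h1 wr; set r2 := r.+1%:R; lra.
Qed.

Hypothesis U0 : forall r : R, 0 <= U.[r].
Context (CU CL : R).
Hypotheses (CU1 : 1 <= CU) (hCU : forall q, 1 + q ^+ 4 <= CU * (U.[q] + 1)).
Hypotheses (CL0 : 0 <= CL) (hCL : forall a b,
  `|U^`().[a] - U^`().[b]| <= CL * (1 + a ^+ 2 + b ^+ 2) * `|a - b|).
Context (Phi : R -> config R d -> config R d).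
Hypothesis inv : forall f, local_obs f -> forall t : R,
       (\int[om]_x (f (Phi t x))%:E = \int[om]_x (f x)%:E)%E.

(** The moment bound for the cube [k = 0] makes the integral of the cutoff at least 1 - exp(C - lam
    z). Invariance transports this to time [t], and [invariant_outer_bound] converts it into a cover
    of the high-energy event. *)
Lemma energy_tail t k z : exists B : set (Xmeas R d), [/\ measurable B,
  (forall x, ~ energy U (Phi t x) k <= z -> B x) & (om B <= (4 * expR (C - lam * z))%:E)%E].
Proof.
pose F (x : Xmeas R d) : R := cutoff lam (lam * z) (energy U x k).
have mF : measurable_fun setT F.
  apply: (@continuous_measurable R d F).
  apply: (@continuous_site_fun R d k (fun v => cutoff lam (lam * z) (site_energy U v))) => v.
  apply: (@cvg_comp _ _ _ (site_energy U) (cutoff lam (lam * z))).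
    exact: continuous_site_energy.
  apply: differentiable_continuous; apply/derivable1_diffP.
  by have [] := is_derive_cutoff lam (lam * z) (site_energy U v).
have mE : measurable_fun setT (fun x : Xmeas R d => expR (lam * Wloc K U k 0 x)).
  by apply: measurableT_comp => //; apply: measurable_funM => //; exact: measurable_Wloc.
have mF' : measurable_fun setT (fun x : Xmeas R d => (F x)%:E) by exact/measurable_EFinP.
have mE' : measurable_fun setT (fun x : Xmeas R d => (expR (lam * Wloc K U k 0 x))%:E).
  exact/measurable_EFinP.
have mcE : measurable_fun setT (fun x : Xmeas R d =>
    (expR (- (lam * z)))%:E * (expR (lam * Wloc K U k 0 x))%:E)%E by exact: measurable_funeM.
have F0 x : setT x -> (0 <= (F x)%:E)%E.
  by rewrite lee_fin; case/andP: (cutoff_ge0 lam (lam * z) (energy U x k)).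
have hF : ((1 - expR (C - lam * z))%:E <= \int[om]_x (F x)%:E)%E.
  have key : (1 <= \int[om]_x (F x)%:E + (expR (C - lam * z))%:E)%E.
    apply: (@le_trans _ _ (\int[om]_x ((F x)%:E
       + (expR (- (lam * z)))%:E * (expR (lam * Wloc K U k 0 x))%:E))%E).
      rewrite -[leLHS](@probability_setT _ _ _ om) -[leLHS]mul1e -(integral_cst om measurableT 1%E).
      apply: ge0_le_integral => //.
      - exact: emeasurable_funD.
      - move=> x _; rewrite -EFinM -EFinD lee_fin.
        apply: le_trans (cutoff_lower lam (lam * z) (energy U x k)) _.
        rewrite lerD2l; apply: ler_wpM2l; first exact: expR_ge0.
        by rewrite ler_expR; apply: ler_wpM2l; [exact: ltW|exact: energy_le_Wloc].
    have E0 x : setT x -> (0 <= (expR (- (lam * z)))%:E * (expR (lam * Wloc K U k 0 x))%:E)%E.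
      by rewrite -EFinM lee_fin mulr_ge0 // expR_ge0.
    rewrite (ge0_integralD om measurableT F0 mF' E0 mcE).
    apply: leeD2l; rewrite ge0_integralZl //.
    rewrite (addrC C) expRD EFinM; apply: lee_wpmul2l; first by rewrite lee_fin expR_ge0.
    by have := hW k 0; rewrite muln0 add0n exp1n mulr1.
  have Fge0 : (0 <= \int[om]_x (F x)%:E)%E.
    exact: integral_ge0.
  move: key Fge0; case: (\int[om]_x (F x)%:E)%E => [r| |] //; rewrite ?leey //.
  by rewrite -EFinD !lee_fin; lra.
have [B [mB hB oB]] := @invariant_outer_bound R _ (Xmeas R d) om F (Phi t) (expR (C - lam * z))
  (expR_gt0 _) (fun x => cutoff_ge0 _ _ _)
  (inv (local_obs_cutoff U0 CU1 hCU CL0 hCL (lam * z) k l0) t) hF.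
exists B; split => // x /negP; rewrite -ltNge => hx; apply: hB.
by apply: cutoff_small => //; exact: ltW.
Qed.

Lemma ae_energy_integer_times :
  {ae om, forall x : Xmeas R d, exists A, forall n k,
    energy U (Phi n%:R x) k <= A * logw n%:R (sdist k (origin d))}.
Proof.
(* In units of r + 1: C for the moment, 2 for the factor 4 <= exp 2, 2(d + 1) for the number of
   pairs, at most exp((r + 2)(d + 1)), and 1 for the summable decay. *)
pose c1 := C + 2 + 2 * (d + 1)%:R + 1.
pose z (A r : nat) : R := (A%:R + c1) * r.+1%:R / lam.
have c10 : 0 <= c1 by rewrite /c1 !addr_ge0 // ?mulr_ge0 // ltW.
have hP := @ae_exists_forall R _ (Xmeas R d) om (fun A r x =>
  forall n k, (n <= 2 ^ r)%N -> (sdist k (origin d) <= 2 ^ r)%N ->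
    energy U (Phi n%:R x) k <= z A r).
apply: filterS (hP _) => [x [A hA]|A r].
  exists ((A%:R + c1) / lam * 4) => n k.
  have [r [h1 h2 h3]] := dyadic_scale R (sdist k (origin d)) n.
  apply: le_trans (hA r n k h2 h1) _; rewrite /z -!mulrA; apply: ler_wpM2l.
    by rewrite addr_ge0.
  by rewrite mulrC; apply: ler_wpM2l => //; rewrite invr_ge0 ltW.
pose J : finType := ({ffun 'I_d -> 'I_(2 * 2 ^ r + 1)} * 'I_(2 ^ r).+1)%type.
have [|B [mB hB oB]] := @finite_union_bound R _ (Xmeas R d) om J (enum J)
  (fun j x => energy U (Phi (nat_of_ord j.2)%:R x) (cube_pt (origin d) j.1) <= z A r)
  (4 * expR (C - lam * z A r)).
  by move=> j _; exact: energy_tail.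
exists B; split => //.
  move=> x nP; apply: hB => h; apply: nP => n k hn hk.
  have [w <-] := in_cube hk.
  by have := h (w, Ordinal (hn : (n < (2 ^ r).+1)%N)); rewrite mem_enum; apply.
apply: le_trans oB _; rewrite lee_fin -cardE card_prod card_ord card_cube.
have hcard : ((2 * 2 ^ r + 1) ^ d * (2 ^ r).+1)%:R <= expR (r.+2%:R * (d + 1)%:R) :> R.
  apply: (@le_trans _ _ ((2 ^ r.+2) ^ (d + 1))%:R).
    rewrite ler_nat expnD expn1; have h1 : (0 < 2 ^ r)%N by rewrite expn_gt0.
    apply: leq_mul; last by rewrite !expnS; lia.
    by rewrite leq_exp2r // !expnS; lia.
  rewrite natrX natrX -exprM mulrC -natrM (mulnC (d + 1)%N).
  by rewrite -[X in expR X]mulr1 expRM_natl lerXn2r ?nnegrE ?expR_ge0 // expR1_ge2.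
have h4 : 4 <= expR 2 :> R.
  have -> : (2 : R) = 2%:R * 1 by rewrite mulr1.
  rewrite expRM_natl; have -> : (4 : R) = 2 ^+ 2 by rewrite -natrX.
  by rewrite lerXn2r ?nnegrE ?expR_ge0 // expR1_ge2.
apply: le_trans (_ : expR (r.+2%:R * (d + 1)%:R) * (expR 2 * expR (C - lam * z A r)) <= _).
  have h5 := ler_wpM2r (expR_ge0 (C - lam * z A r)) h4.
  by apply: ler_pM => //; rewrite mulr_ge0 ?expR_ge0.
have -> : 2^-1 ^+ A / (2 ^ r.+1)%:R = 2^-1 ^+ (A + r.+1) :> R.
  by rewrite exprD natrX (exprVn _ r.+1).
apply: le_trans (expRN_le_half_pow R (A + r.+1)).
rewrite -!expRD ler_expR /z.
have -> : lam * ((A%:R + c1) * r.+1%:R / lam) = (A%:R + c1) * r.+1%:R.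
  by rewrite mulrCA mulfV ?mulr1 // gt_eqF.
have r1 : 1 <= r.+1%:R :> R by rewrite ler1n.
have rr : r.+2%:R <= 2 * r.+1%:R :> R by rewrite -(natr1 r.+1); lra.
have D0 : 0 <= (d + 1)%:R :> R by [].
have h1 := ler_wpM2r D0 rr; rewrite natrD /c1.
have h2 : A%:R * 1 <= A%:R * r.+1%:R :> R by apply: ler_wpM2l.
have h3 : (C + 2) * 1 <= (C + 2) * r.+1%:R by apply: ler_wpM2l => //; rewrite addr_ge0 // ltW.
by move: h1 h2 h3; set D := (d + 1)%:R; set r1' := r.+1%:R; set r2 := r.+2%:R; lra.
Qed.

End AlmostEverywhere.

Unset Implicit Arguments.

Theorem theorem2p2 (R : realType) (d : nat) (K : R) (U : {poly R})
  (Phi : R -> config R d -> config R d) (om : probability (Xmeas R d) R)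
  (f g : R * R -> R) :
  (1 <= d)%N -> 0 < K ->
  size U = 5%N -> 0 < lead_coef U -> (forall r : R, 0 <= U.[r]) ->
  is_flow K U Phi ->
  time_invariant_state K U Phi om ->
  bounded_C1 f -> bounded_C1 g ->
  forall (i : site d) (alpha b : R), 1 / 2 < alpha -> 0 < b ->
  {ae om, forall x : Xmeas R d,
     (ereal_sup [set r : \bar R | exists j : site d,
                   t * (ln t) `^ alpha < (sdist i j)%:R /\
                   r = (expR (b * t) *
                        pbracket [:: i] (fun y : config R d => f (y i))
                                 (fun y : config R d => g (Phi t y j)) x)%:E])
       @[t --> +oo] --> (0 : \bar R)}.
Proof.
move=> d0 K0 sU lU U0 flow [[C [C0 [lam0 [lam00 hW]]]] inv] hf hg i alpha b al12 b0.
have [CU [CU1 hCU]] := quartic_lower_bound sU lU U0.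
have [CL [CL0 hCL]] := deriv_quartic_lipschitz sU.
have l0 : 0 < lam0 / 2 by rewrite divr_gt0.
have ll0 : lam0 / 2 < lam0 by rewrite ltr_pdivrMr // ltr_pMr // ltr1n.
have hWl := hW _ l0 ll0.
have aeX := ae_X0 C0 l0 hWl d0 K0.
have aeE := ae_energy_integer_times C0 l0 hWl d0 K0 U0 CU1 hCU CL0 hCL inv.
have FF := ae_filter_ringOfSetsType om.
(* The two null sets depend on neither [i], [alpha], [b] nor [f], [g]; outside them the statement is
   deterministic. *)
apply: filterS2 aeX aeE => x x0 [A hA].
exact: (deterministic_limit d0 K0 U0 CU1 hCU CL0 hCL flow i hf hg al12 b0 x0 hA).
Qed.
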